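(* For any fixed $\beta'>1$, as $\beta\downarrow 1$, $$\mathbb{E}\left[Q(\beta,\beta')\right]=(\beta-1)\log\frac{1}{\beta-1}+O(\beta-1).$$
   Context: Let $(\xi_i)_{i\ge 1}$ be the atoms of a Poisson point process on $\mathbb{R}$ with intensity measure $e^{-x}\,dx$ (the limiting extremal process of the Random Energy Model, REM, whose critical inverse temperature is $\beta_c=1$). For $\beta,\beta'>1$, define the random variable $$Q(\beta,\beta')=\frac{\sum_{i\ge1} e^{\beta\xi_i}e^{\beta'\xi_i}}{\left(\sum_{i\ge1} e^{\beta\xi_i}\right)\left(\sum_{i\ge1} e^{\beta'\xi_i}\right)},$$ where all the sums are almost surely finite. For $f:(1,\infty)\to\mathbb{R}$ and $g:(1,\infty)\to(0,\infty)$, $f(\beta)=O(g(\beta))$ as $\beta\downarrow1$ means $\limsup_{\beta\downarrow1}|f(\beta)|/g(\beta)<\infty$. *)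

(* Defs.v *)
From HB Require Import structures.
From mathcomp Require Import all_boot all_order all_algebra.
From mathcomp Require Import all_classical all_reals all_analysis.
From mathcomp Require Import measurable_realfun.

Set Implicit Arguments.
Unset Strict Implicit.
Unset Printing Implicit Defensive.

Import Order.TTheory GRing.Theory Num.Theory.
Import numFieldNormedType.Exports.

Local Open Scope classical_set_scope.
Local Open Scope ring_scope.

(* Taking [B i := setT] for some of the [i] yields the product rule for every
   subfamily. *)
Definition mutually_independent (R : realType) (d : measure_display)
    (T : measurableType d) (P : probability T R)
    (n : nat) (X : 'I_n -> T -> \bar R) : Prop :=
  forall B : 'I_n -> set (\bar R), (forall i, measurable (B i)) ->
    P (\bigcap_i (X i @^-1` B i)) = (\prod_(i < n) P (X i @^-1` B i))%E.

(* Atoms are counted with multiplicity, so that [atom_count xi w] is the random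
   measure having the [xi i w] as atoms. *)
Definition atom_count (R : realType) (T : Type) (xi : nat -> T -> R)
    (w : T) (A : set R) : \bar R :=
  (\sum_(i <oo) \d_(xi i w) A)%E.

(* The second argument of [poisson_prob] is a dummy. [poisson_prob 0] is the
   Dirac mass at 0, whereas [poisson_pmf 0] is constantly 1. The Poisson law of
   infinite parameter is the Dirac mass at infinity. *)
Definition poisson_point_process (R : realType) (d : measure_display)
    (T : measurableType d) (P : probability T R) (mu : set R -> \bar R)
    (xi : nat -> {RV P >-> R}) : Prop :=
  let N (A : set R) (w : T) := atom_count xi w A in
  [/\ forall (A : set R) (r : R) (k : nat), measurable A -> mu A = r%:E ->
        P [set w | N A w = k%:R%:E] = poisson_prob r 0%N [set k],
      forall A : set R, measurable A -> mu A = +oo%E ->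
        P [set w | N A w = +oo%E] = 1%E
    & forall (n : nat) (A : 'I_n -> set R), (forall i, measurable (A i)) ->
        trivIset setT A -> mutually_independent P (fun i => N (A i))].

Definition rem_intensity (R : realType) (A : set R) : \bar R :=
  (\int[lebesgue_measure]_(x in A) (expR (- x))%:E)%E.

(* The three sums are extended reals; [fine] only matters on the null event
   where one of them is infinite. *)
Definition rem_overlap (R : realType) (T : Type) (xi : nat -> T -> R)
    (b b' : R) (w : T) : R :=
  fine (\sum_(i <oo) (expR (b * xi i w) * expR (b' * xi i w))%:E)%E /
  (fine (\sum_(i <oo) (expR (b * xi i w))%:E)%E *
   fine (\sum_(i <oo) (expR (b' * xi i w))%:E)%E).

(* Main.v *)
Require Import Defs.
From HB Require Import structures.
From mathcomp Require Import all_boot all_order all_algebra.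
From mathcomp Require Import all_classical all_reals all_analysis.
From mathcomp Require Import measurable_realfun.
From mathcomp Require Import ring lra.

(** Put [e = b - 1] and let [Q] be the overlap, so that the claim is
    [E Q = e * ln (1 / e) + O(e)]. Call an atom high if it is positive and low otherwise. The idea is that the sum
    of the weights [expR (b * xi i)] over the low atoms is almost deterministic:
    its mean is [1 / e] and its distance [Z] to [1 / e] is bounded in L1
    uniformly in [b] (lemmas [mean_low_sum] and [mean_low_deviation]). A high
    atom of weight [a] therefore has a share close to [a / (1 / e + a)] of the
    total weight, the averaged share, and only the highest atom matters.

    Upper bound. [Q] is a convex combination, with the weights at the
    inverse temperature [b'], of the shares of the atoms at [b]. The
    share of a high atom is at most its averaged share plus [e * Z], that of a
    low atom is at most [e + e * Z]. Bounding the convex combination of the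
    averaged shares by their sum [H] over all high atoms gives
    [Q <= H + e + e * Z] ([overlap_le]).

    Lower bound. Keep in [Q] the term of the highest atom only. The error is at
    most [e] times a combination of [Z], of the total weight [W] of the high
    atoms other than the highest one, and of the sum [R'] of the weights
    at [b'] over the low atoms. The averaged share of a high atom is at most [e]
    times its weight, so that [H] exceeds the averaged share of the highest atom
    by at most [e * W]. Altogether [H <= Q + e * (3 * W + 2 * Z + R')]
    ([overlap_ge]). An atom which is counted in [W] and lies above [k] forces a
    second atom above [k]; since the number of atoms above [k] is Poisson of
    parameter [expR (- k)], the expectation of [W] is bounded by
    [\sum_k expR (b * (k + 1)) * expR (- 2 * k)], which converges for [b < 2]
    ([mean_excess_sum]).

    It remains to evaluate the expectation of [H]. By Campbell's formula
    ([campbell]) it is the integral over [x > 0] of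
    [e * expR (e * x) / (1 + e * expR (b * x))], whose integrand is close to [e]
    up to [x = ln (1 / e)] and negligible beyond: the integral is
    [e * ln (1 / e) + O(e)] ([high_intensity_le] and [high_intensity_ge]). *)

Import Order.TTheory GRing.Theory Num.Theory.
Import numFieldNormedType.Exports.

Local Open Scope classical_set_scope.
Local Open Scope ring_scope.

Set Implicit Arguments.
Unset Strict Implicit.
Unset Printing Implicit Defensive.

(** * Integration against a density *)

Section density.
Local Open Scope ereal_scope.
Context d (X : measurableType d) (R : realType).
Variables (mu nu : {measure set X -> \bar R}) (g : X -> R).
Hypothesis g_ge0 : forall x, (0 <= g x)%R.
Hypothesis mg : measurable_fun setT g.
Hypothesis nuE : forall A, measurable A -> nu A = \int[mu]_(x in A) (g x)%:E.

Import HBNNSimple.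

(** The hypothesis is the claim for indicators; it extends to simple functions by
    linearity and to nonnegative functions by monotone convergence. *)
Lemma ge0_integral_density (f : X -> \bar R) : (forall x, 0 <= f x) ->
  measurable_fun setT f -> \int[nu]_x f x = \int[mu]_x (f x * (g x)%:E).
Proof.
move=> f0 mf.
have mgE : measurable_fun setT (EFin \o g) by exact/measurable_EFinP.
have gE0 x : 0 <= (EFin \o g) x by rewrite /= lee_fin.
pose h := nnsfun_approx measurableT mf.
have -> : \int[nu]_x f x = limn (fun n => \int[nu]_x (EFin \o h n) x).
  have fE x : f x = limn (fun n => (EFin \o h n) x).
    by apply/esym/cvg_lim => //; exact: cvg_nnsfun_approx.
  under eq_integral do rewrite fE.
  apply: monotone_convergence => //.
  - by move=> n; apply/measurable_EFinP; exact/measurable_funP.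
  - by move=> n x _ /=; rewrite lee_fin.
  - by move=> x _ a b ab; rewrite lee_fin; exact/lefP/nd_nnsfun_approx.
have -> : \int[mu]_x (f x * (g x)%:E) =
    limn (fun n => \int[mu]_x ((EFin \o h n) x * (g x)%:E)).
  have fE x : f x * (g x)%:E = limn (fun n => (EFin \o h n) x * (g x)%:E).
    apply/esym/cvg_lim => //; apply: cvgeZr => //.
    exact: cvg_nnsfun_approx.
  under eq_integral do rewrite fE.
  apply: monotone_convergence => //.
  - move=> n; apply: emeasurable_funM => //; apply/measurable_EFinP.
    exact/measurable_funP.
  - by move=> n x _ /=; rewrite mule_ge0// lee_fin.
  - move=> x _ a b ab; rewrite lee_wpmul2r ?lee_fin//.
    exact/lefP/nd_nnsfun_approx.
suff suf n : \int[nu]_x (EFin \o h n) x = \int[mu]_x ((EFin \o h n) x * (g x)%:E).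
  by under eq_fun do rewrite suf.
have mind r : measurable_fun setT (fun x => (r * \1_(h n @^-1` [set r]) x)%:E).
  by apply/measurable_EFinP; exact: measurable_funM.
transitivity (\int[nu]_x
   (\sum_(y \in range (h n)) (y * \1_(h n @^-1` [set y]) x)%:E)).
  by apply: eq_integral => t _; rewrite /= fimfunE -fsumEFin.
rewrite ge0_integral_fsum//; last by move=> m y _; exact: nnfun_muleindic_ge0.
transitivity (\int[mu]_x (\sum_(y \in range (h n))
    (y * \1_(h n @^-1` [set y]) x)%:E * (g x)%:E)); last first.
  apply: eq_integral => x _.
  rewrite -ge0_mule_fsuml => [|y]; last exact: nnfun_muleindic_ge0.
  by rewrite fsumEFin // -(fimfunE _ x).
rewrite ge0_integral_fsum//; last 2 first.
- by move=> y; exact: emeasurable_funM.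
- move=> m y _; apply: mule_ge0; first exact: nnfun_muleindic_ge0.
  by rewrite lee_fin.
apply: eq_fsbigr => r /[!inE] -[x _ <-].
set A := h n @^-1` _.
have mA : measurable A by rewrite -[A]setTI; exact: measurable_funP.
have h0 : (0 <= h n x)%R by [].
under eq_integral do rewrite EFinM.
rewrite ge0_integralZl//; last exact/measurable_EFinP.
under [RHS]eq_integral do rewrite EFinM -muleA.
rewrite [RHS]ge0_integralZl//; last 2 first.
- by apply: emeasurable_funM => //; exact/measurable_EFinP.
- by move=> y _; rewrite mule_ge0// lee_fin.
rewrite integral_indic// setIT nuE// integral_mkcond; congr (_ * _).
apply: eq_integral => y _; rewrite patchE indicE.
by case: (y \in A); rewrite ?mul1e ?mul0e.
Qed.

End density.

(** * Moments of Poisson counts *)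

Section poisson_moments.
Local Open Scope ereal_scope.
Context (R : realType) (r : R).
Hypothesis r_ge0 : (0 <= r)%R.

Lemma poisson_prob_set1 (k : nat) :
  poisson_prob r 0%N [set k] = (r ^+ k / k`!%:R * expR (- r))%:E.
Proof.
rewrite /poisson_prob; case: ifPn => [r0|]; last first.
  rewrite -leNgt => r0; have -> : r = 0%R by apply/le_anti/andP.
  rewrite diracE oppr0 expR0 mulr1.
  case: k => [|k]; first by rewrite mem_set// expr0 fact0 divr1.
  by rewrite memNset// expr0n mul0r.
rewrite esum_set1 /poisson_pmf ?r0// lee_fin.
by rewrite !mulr_ge0 ?expR_ge0 ?exprn_ge0 ?invr_ge0.
Qed.

Lemma nneseries_exp_coeff : \sum_(k <oo) (r ^+ k / k`!%:R)%:E = (expR r)%:E.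
Proof.
rewrite expRE -EFin_lim; last first.
  rewrite /pseries/=; under eq_fun do rewrite mulrC.
  exact: is_cvg_series_exp_coeff.
apply/congr_lim/funext => n/=; rewrite /pseries/= /series/= -sumEFin//.
by under eq_bigr do rewrite mulrC.
Qed.

(** The factor [k ^_ j] cancels against [k`!] and leaves the exponential series
    shifted by [j]. The three moments of order at most 2 give the mean and the
    variance. *)
Lemma poisson_factorial_moment (j : nat) :
  \sum_(k <oo) ((k ^_ j)%:R%:E * poisson_prob r 0%N [set k]) = (r ^+ j)%:E.
Proof.
have p0 k : 0 <= (k ^_ j)%:R%:E * poisson_prob r 0%N [set k].
  by rewrite mule_ge0// lee_fin.
rewrite (nneseries_split 0%N j)// add0n big1_seq ?add0e; last first.
  move=> k /andP[_]; rewrite mem_index_iota => /andP[_ kj].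
  by rewrite ffact_small// mul0e.
rewrite -[X in \sum_(X <= _ <oo) _]add0n.
rewrite -(@nneseries_addn _ (fun k => (k ^_ j)%:R%:E * poisson_prob r 0%N [set k]))//.
transitivity (\sum_(k <oo) ((r ^+ j * expR (- r))%:E * (r ^+ k / k`!%:R)%:E)).
  apply: eq_eseriesr => k _; rewrite poisson_prob_set1 -!EFinM; congr EFin.
  rewrite -(ffact_fact (leq_addl k j)) addnK natrM exprD.
  have f0 : (((k + j) ^_ j)%:R)%R != 0%R :> R.
    by rewrite pnatr_eq0 -lt0n ffact_gt0 leq_addl.
  have g0 : ((k`!)%:R)%R != 0%R :> R by rewrite pnatr_eq0 -lt0n fact_gt0.
  by field; rewrite f0 g0.
rewrite nneseriesZl => [|k _]; last by rewrite lee_fin divr_ge0// exprn_ge0.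
by rewrite nneseries_exp_coeff -EFinM -mulrA -expRD addNr expR0 mulr1.
Qed.

End poisson_moments.
(** The counting variables take their values in the extended reals, so that
    laws on [nat] have to be transported. *)
Section poisson_count.
Local Open Scope ereal_scope.
Context d (T : measurableType d) (R : realType) (P : probability T R).
Variables (N : T -> \bar R) (r : R).
Hypothesis r_ge0 : (0 <= r)%R.
Hypothesis mN : measurable_fun setT N.
Hypothesis N_poisson : forall k : nat,
  P [set w | N w = k%:R%:E] = poisson_prob r 0%N [set k].

(** The events [N = k] are disjoint and exhaust the probability 1. *)
Lemma poisson_expectation (g : \bar R -> \bar R) : (forall y, 0 <= g y) ->
  measurable_fun setT g ->
  \int[P]_w g (N w) = \sum_(k <oo) (g k%:R%:E * poisson_prob r 0%N [set k]).
Proof.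
move=> g0 mg.
pose E k := N @^-1` [set k%:R%:E].
have mE k : measurable (E k).
  by rewrite -[E k]setTI; apply: mN => //; exact: emeasurable_set1.
have tE : trivIset setT E.
  apply/trivIsetP => i j _ _ ij; rewrite -subset0 => w [/= + Nj].
  rewrite /E/= Nj => -[/eqP].
  by rewrite eqr_nat eq_sym (negbTE ij).
have mD : measurable (\bigcup_k E k) by exact: bigcup_measurable.
have mgN : measurable_fun setT (g \o N) by exact: measurableT_comp.
have PE k : P (E k) = poisson_prob r 0%N [set k] by exact: N_poisson.
have PD : P (\bigcup_k E k) = 1.
  rewrite measure_bigcup// -[RHS](poisson_factorial_moment r_ge0 0).
  rewrite (@eq_eseriesl _ _ xpredT); last by move=> k; rewrite in_setT.
  by apply: eq_eseriesr => k _; rewrite ffactn0 mul1e; exact: PE.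
have PC : P (~` \bigcup_k E k) = 0 by rewrite probability_setC// PD subee.
rewrite (ge0_negligible_integral _ _ _ _ PC)//=; last exact: measurableC.
rewrite setTD setCK ge0_integral_bigcup//; last exact: measurable_funTS.
apply: eq_eseriesr => k _; transitivity (\int[P]_(w in E k) (cst (g k%:R%:E)) w).
  by apply: eq_integral => w /[!inE] /= ->.
by rewrite integral_cst//; congr (_ * _); exact: PE.
Qed.

Lemma poisson_mean : (forall w, 0 <= N w) -> \int[P]_w N w = r%:E.
Proof.
move=> N0; transitivity (\int[P]_w maxe (N w) 0).
  by apply: eq_integral => w _; apply/esym/max_idPl.
rewrite (poisson_expectation (g := fun y => maxe y 0)); last 2 first.
- by move=> y; rewrite le_max lexx orbT.
- exact: measurable_maxe.
rewrite -[RHS](poisson_factorial_moment r_ge0 1).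
apply: eq_eseriesr => k _; rewrite ffactn1; congr (_ * _).
by apply/max_idPl; rewrite lee_fin.
Qed.

(** For an integer [k], the excess of [k] over 1 is at most [k * (k - 1)], whose
    expectation is the second factorial moment. *)
Lemma poisson_excess : \int[P]_w maxe (N w - 1) 0 <= (r ^+ 2)%:E.
Proof.
rewrite (poisson_expectation (g := fun y => maxe (y - 1) 0)); last 2 first.
- by move=> y; rewrite le_max lexx orbT.
- by apply: measurable_maxe => //; exact: emeasurable_funB.
rewrite -(poisson_factorial_moment r_ge0 2).
apply: lee_nneseries => [k _ _|k _]; first by rewrite mule_ge0// le_max lexx orbT.
rewrite lee_wpmul2r// -EFinB ge_max !lee_fin ler0n andbT.
case: k => [|k]; first by rewrite sub0r (@le_trans _ _ 0%R) ?lerN10 ?ler0n.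
rewrite -natr1 addrK ler_nat ffactnS ffactn1.
by rewrite leq_pmull.
Qed.

(** By the inequality [y <= c + y ^+ 2 / c], the first absolute moment is
    controlled by the variance [r], without taking a square root. *)
Lemma poisson_deviation (c : R) : (0 < c)%R ->
  \int[P]_w `|N w - r%:E| <= (c + r / c)%:E.
Proof.
move=> c0.
rewrite (poisson_expectation (g := fun y => `|y - r%:E|)); last 2 first.
- by move=> y; exact: abse_ge0.
- by apply: measurableT_comp => //; exact: emeasurable_funB.
have p0 k : 0 <= poisson_prob r 0%N [set k] by [].
have fm j := poisson_factorial_moment r_ge0 j.
pose p k := poisson_prob r 0%N [set k].
pose D := \sum_(k <oo) (((k%:R - r) ^+ 2)%:E * p k).
have D0 : 0 <= D.
  by apply: nneseries_ge0 => k _ _; rewrite mule_ge0// lee_fin sqr_ge0.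
have DE : D = r%:E.
  pose S j := \sum_(k <oo) ((k ^_ j)%:R%:E * p k).
  have S0 j k : 0 <= (k ^_ j)%:R%:E * p k by rewrite mule_ge0// lee_fin.
  have : D + (2 * r)%:E * S 1%N = S 2%N + S 1%N + (r ^+ 2)%:E * S 0%N.
    rewrite /D /S -!nneseriesZl//.
    rewrite -nneseriesD; last 2 first.
    - by move=> k _ _; rewrite mule_ge0// lee_fin sqr_ge0.
    - by move=> k _ _; rewrite mule_ge0// lee_fin mulr_ge0.
    rewrite -[in RHS]nneseriesD//.
    rewrite -[in RHS]nneseriesD; last 2 first.
    - by move=> k _ _; rewrite adde_ge0.
    - by move=> k _ _; rewrite mule_ge0// lee_fin sqr_ge0.
    apply: eq_eseriesr => k _; rewrite /p poisson_prob_set1// -!EFinM -!EFinD.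
    congr EFin; rewrite !ffactn1 ffactnS ffactn1 ffactn0 natrM.
    case: k => [|k]; first by rewrite mul0r; ring.
    by rewrite /= -natr1; ring.
  rewrite /S /p !fm expr1 mule1; move: D0; case: D => [x _|_|//].
    by rewrite -EFinM -!EFinD => -[] xE; congr EFin; move: xE; lra.
  by rewrite -EFinM.
apply: (@le_trans _ _ (c%:E * 1 + (c^-1)%:E * D)); last first.
  by rewrite DE mule1 -EFinM -EFinD lee_fin mulrC.
rewrite -[X in _ * X + _](fm 0%N) -nneseriesZl; last first.
  by move=> k _; rewrite mule_ge0// lee_fin.
rewrite /D -nneseriesZl; last by move=> k _; rewrite mule_ge0// lee_fin sqr_ge0.
rewrite -nneseriesD; last 2 first.
- by move=> k _ _; rewrite mule_ge0// ?mule_ge0// lee_fin// ltW.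
- move=> k _ _; rewrite mule_ge0// ?mule_ge0// lee_fin ?sqr_ge0//.
  by rewrite invr_ge0 ltW.
apply: lee_nneseries => [k _ _|k _]; first by rewrite mule_ge0.
rewrite ffactn0 mul1e muleA -ge0_muleDl ?lee_fin ?(ltW c0)//; last first.
  by rewrite mulr_ge0 ?sqr_ge0// invr_ge0 ltW.
rewrite lee_wpmul2r//= lee_fin.
rewrite -(real_normK (num_real (k%:R - r)%R)).
set x := `|k%:R - r|%R.
have -> : (c + c^-1 * x ^+ 2 = x + ((c - x) ^+ 2 + c * x) / c)%R.
  by field; rewrite gt_eqF.
rewrite lerDl; apply: divr_ge0; last exact: ltW.
by rewrite addr_ge0 ?sqr_ge0// mulr_ge0 ?normr_ge0// ltW.
Qed.

End poisson_count.
(** * Exponential integrals and the intensity measure *)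

Section exponential_integrals.
Local Open Scope ereal_scope.
Context {R : realType}.
Local Notation leb := (@lebesgue_measure R).

Lemma measurable_expRM (D : set R) (a : R) :
  measurable_fun D (fun x => expR (a * x)).
Proof.
by apply: measurable_funTS; apply: measurableT_comp => //; exact: mulrl_measurable.
Qed.

Lemma integral_expRN_itvcy (a s : R) : (0 < a)%R ->
  \int[leb]_(x in `[s, +oo[) (expR (- a * x))%:E = (expR (- a * s) / a)%:E.
Proof.
move=> a0.
have cE : continuous (fun x : R => expR (- a * x)).
  move=> x; apply: continuous_comp; last exact: continuous_expR.
  exact: mulrl_continuous.
pose F (x : R) := (- (expR (- a * x) / a))%R.
have cF : continuous F.
  by move=> x; apply: cvgN; apply: cvgMl; exact: cE.
have dF (x : R) : is_derive x 1%R F (expR (- a * x)).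
  have -> : F = (- a^-1)%R \*: (expR \o (- a)%R \*: (@idfun R)).
    by apply/funext => y; rewrite /F/= /GRing.scale/= [RHS]mulNr mulrC.
  apply: is_derive_eq; rewrite /GRing.scale/= mulr1 mulrC.
  by rewrite -mulrA mulrNN mulfV ?mulr1 ?gt_eqF.
rewrite (@ge0_continuous_FTC2y _ (fun x => expR (- a * x)) F _ 0%R).
- by rewrite /F EFinN oppeK add0e.
- by move=> x _; exact: expR_ge0.
- exact: continuous_subspaceT.
- rewrite -oppr0; apply: cvgN; rewrite -(mul0r (a^-1)%R); apply: cvgMl.
  rewrite (_ : (fun x => expR (- a * x)) =
               (fun z : R => expR (- z)) \o (fun z : R => (a * z)%R)); last first.
    by apply: eq_fun => x; rewrite mulNr.
  apply: (@cvg_comp _ _ _ _ _ _ (pinfty_nbhs R)); last exact: cvgr_expR.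
  exact: gt0_cvgMry.
- by move=> x _; exact: ex_derive.
- by apply: cvg_at_right_filter; exact: cF.
- by move=> x _; rewrite derive1E; exact: derive_val.
Qed.

Lemma integral_expR_itvNyc (a c : R) : (0 < a)%R ->
  \int[leb]_(x in `]-oo, c]) (expR (a * x))%:E = (expR (a * c) / a)%:E.
Proof.
move=> a0; rewrite -[c]opprK ge0_integration_by_substitutionNy.
- under eq_integral do rewrite /= mulrN -mulNr.
  by rewrite integral_expRN_itvcy// mulNr -mulrN.
- apply: continuous_subspaceT => x.
  apply: continuous_comp; last exact: continuous_expR.
  exact: mulrl_continuous.
- by move=> x _; exact: expR_ge0.
Qed.

End exponential_integrals.

Section rem_intensity_measure.
Local Open Scope ereal_scope.
Context {R : realType}.
Local Notation mu := (@rem_intensity R).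

Lemma measurable_expRN : measurable_fun [set: R] (fun x => (expR (- x))%:E).
Proof. by apply/measurable_EFinP; exact: measurableT_comp. Qed.

Let mu0 : mu set0 = 0.
Proof. by rewrite /rem_intensity integral_set0. Qed.

Let mu_ge0 A : 0 <= mu A.
Proof. by apply: integral_ge0 => x _; rewrite lee_fin expR_ge0. Qed.

Let mu_semi_sigma_additive : semi_sigma_additive mu.
Proof.
move=> /= F mF tF mUF; rewrite /rem_intensity; apply: cvg_toP.
  apply: ereal_nondecreasing_is_cvgn => m n mn.
  apply: lee_sum_nneg_natr => // k _ _; apply: integral_ge0 => /= x Fkx.
  by rewrite lee_fin expR_ge0.
rewrite ge0_integral_bigcup//=.
by apply/measurable_funTS; exact: measurable_expRN.
Qed.

HB.instance Definition _ := isMeasure.Build _ _ _ mu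
  mu0 mu_ge0 mu_semi_sigma_additive.

Lemma rem_intensity_itvcy (s : R) : mu `[s, +oo[ = (expR (- s))%:E.
Proof.
have := @integral_expRN_itvcy R 1%R s ltr01; rewrite divr1 mulN1r => <-.
by apply: eq_integral => x _; rewrite mulN1r.
Qed.

Lemma rem_intensity_itvoy (s : R) : mu `]s, +oo[ = (expR (- s))%:E.
Proof.
rewrite -rem_intensity_itvcy /rem_intensity integral_itv_obnd_cbnd//.
exact: measurable_funTS measurable_expRN.
Qed.

(** Two structures of measurable space on the reals are in use here, the Borel
    one over which the Lebesgue measure lives and the default one; the identity
    map [toB] transports the integral from one to the other. *)
Lemma integral_rem_intensity (f : R -> \bar R) : (forall x, 0 <= f x) ->
  measurable_fun setT f ->
  \int[mu]_x f x = \int[lebesgue_measure]_x (f x * (expR (- x))%:E).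
Proof.
move=> f0 mf.
pose toB : R -> measurableTypeR R := idfun.
have mtoB : measurable_fun setT toB by move=> _ Y mY; rewrite setTI.
transitivity (\int[pushforward mu toB]_x f x).
  by rewrite (ge0_integral_pushforward mtoB).
apply: (ge0_integral_density
  (nu := (pushforward mu toB : {measure set (measurableTypeR R) -> \bar R}))
  (g := fun x : R => expR (- x))) => //.
by apply/measurable_EFinP; exact: measurable_expRN.
Qed.

End rem_intensity_measure.
(** * Campbell's formula *)

Section point_process.
Local Open Scope ereal_scope.
Context d (T : measurableType d) (R : realType) (P : probability T R).
Variables (mu : {measure set R -> \bar R}) (xi : nat -> {RV P >-> R}).
Hypothesis hxi : poisson_point_process mu xi.

Let N (A : set R) (w : T) := atom_count xi w A.

Lemma measurable_dirac_atom i A : measurable A ->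
  measurable_fun setT (fun w => \d_(xi i w) A : \bar R).
Proof.
move=> mA; rewrite (_ : (fun w => _) = EFin \o (\1_A \o xi i)).
  by apply/measurable_EFinP; apply: measurableT_comp => //; exact: measurable_indic.
by apply/funext => w; rewrite diracE /= indicE.
Qed.

Lemma atom_count_ge0 A w : 0 <= N A w.
Proof. exact: nneseries_ge0. Qed.

Lemma measurable_atom_count A : measurable A -> measurable_fun setT (N A).
Proof.
move=> mA; rewrite /N /atom_count.
apply: ge0_emeasurable_sum => [k x _ _|k _]; first exact: measure_ge0.
exact: measurable_dirac_atom.
Qed.

(** A set of infinite intensity is covered by the clause of the definition which
    says that it almost surely contains infinitely many atoms. *)
Lemma mean_atom_count A : measurable A -> \int[P]_w N A w = mu A.
Proof.
move=> mA; have mN := measurable_atom_count mA.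
case muA : (mu A) => [r||].
- have r0 : (0 <= r)%R by rewrite -lee_fin -muA.
  apply: (poisson_mean r0 mN) => [k|w]; last exact: atom_count_ge0.
  by case: hxi => + _ _; apply.
- case: hxi => _ /(_ _ mA muA) PN _.
  apply/eqP; rewrite eq_le leey/=.
  pose E := N A @^-1` [set +oo].
  have mE : measurable E.
    by rewrite -[E]setTI; apply: mN => //; exact: emeasurable_set1.
  apply: (@le_trans _ _ (\int[P]_(w in E) N A w)).
    rewrite (eq_integral (cst +oo)) ?integral_cst//; last by move=> w /[!inE].
    by rewrite [X in _ * X]PN mule1.
  by apply: ge0_subset_integral => // w _; exact: atom_count_ge0.
- by have : 0 <= mu A by []; rewrite muA.
Qed.

(** The sum of the laws of the atoms is a measure, which agrees with [mu] on
    every measurable set by [mean_atom_count]. *)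
Lemma campbell (f : R -> \bar R) : (forall x, 0 <= f x) ->
  measurable_fun setT f ->
  \int[P]_w (\sum_(i <oo) f (xi i w)) = \int[mu]_x f x.
Proof.
move=> f0 mf; have mfxi i : measurable_fun setT (fun w => f (xi i w)).
  exact: measurableT_comp.
rewrite integral_nneseries//.
pose law i : {measure set R -> \bar R} := distribution P (xi i).
transitivity (\int[mseries law 0]_x f x).
  rewrite ge0_integral_measure_series//; apply: eq_eseriesr => i _.
  by rewrite ge0_integral_pushforward.
apply: eq_measure_integral => A mA _.
rewrite -mean_atom_count// integral_nneseries//; last first.
  by move=> i; exact: measurable_dirac_atom.
apply: eq_eseriesr => i _; transitivity (\int[P]_w (\1_(xi i @^-1` A) w)%:E).
  by rewrite integral_indic ?setIT// -[X in measurable X]setTI; exact: measurable_funP.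
by apply: eq_integral => w _; rewrite diracE indicE.
Qed.

End point_process.
(** * The sum over the low atoms and its fluctuations *)

Section ereal_distance.
Local Open Scope ereal_scope.
Context {R : realType}.

Lemma lee_add_abse_sub (x y : \bar R) : 0 <= x -> y \is a fin_num -> x <= y + `|x - y|.
Proof.
case: x y => [x||] [y||]//= _ _.
by rewrite lee_fin addrC -lerBlDr ler_norm.
Qed.

Lemma lee_add_abse_subC (x y : \bar R) : 0 <= x -> y \is a fin_num -> y <= x + `|x - y|.
Proof.
case: x y => [x||] [y||]//= _ _.
by rewrite lee_fin addrC -lerBlDr -opprB ler_normr lexx orbT.
by rewrite leey.
Qed.

End ereal_distance.

Definition low_sum {R : realType} (c : R) (x : nat -> R) : \bar R :=
  (\sum_(i <oo) (expR (c * x i) * \1_(`]-oo, 0]) (x i))%:E)%E.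

Section fluctuation.
Local Open Scope ereal_scope.
Context d (T : measurableType d) (R : realType) (P : probability T R).
Variable xi : nat -> {RV P >-> R}.
Hypothesis hxi : poisson_point_process (@rem_intensity R) xi.
Variable b : R.
Hypothesis b1 : (1 < b)%R.

Local Notation leb := (@lebesgue_measure R).
Let b_gt0 : (0 < b)%R. Proof. exact: lt_trans b1. Qed.
Let phi (s : R) : \bar R := (b * expR (b * s))%:E.
Let lam (s : R) : \bar R := rem_intensity `[s, 0%R].
Let N (s : R) (w : T) : \bar R := atom_count xi w `[s, 0%R].

(** Writing [expR (b * x)] as the integral of [phi] up to [x], the sum over the
    low atoms becomes the integral of [phi s * N s], and its mean the integral of
    [phi s * lam s]. The present quantity bounds their distance, and its
    expectation only involves the first absolute moment of Poisson variables. *)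
Definition low_deviation (w : T) : \bar R := \int[leb]_s (phi s * `|N s w - lam s|).

Lemma measurable_low_weight (c : R) :
  measurable_fun setT (fun x : R => (expR (c * x) * \1_(`]-oo, 0%R]) x)%:E).
Proof.
apply/measurable_EFinP; apply: measurable_funM; first exact: measurable_expRM.
exact: measurable_indic.
Qed.

Lemma low_weight_ge0 (c x : R) : 0 <= (expR (c * x) * \1_(`]-oo, 0%R]) x)%:E.
Proof. by rewrite lee_fin mulr_ge0 ?expR_ge0. Qed.

(** By Campbell's formula this is the integral of [expR ((c - 1) * x)] over the
    negative half-line. *)
Lemma mean_low_sum (c : R) : (1 < c)%R ->
  \int[P]_w low_sum c (xi ^~ w) = ((c - 1)^-1)%:E.
Proof.
move=> c1; rewrite /low_sum.
rewrite (campbell hxi (f := fun x => (expR (c * x) * \1_(`]-oo, 0%R]) x)%:E)).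
- rewrite integral_rem_intensity.
  + transitivity (\int[leb]_(x in `]-oo, 0%R]) (expR ((c - 1) * x))%:E).
      rewrite [RHS]integral_mkcond; apply: eq_integral => x _.
      rewrite patchE indicE; case: ifPn => _; last by rewrite mulr0 mul0e.
      by rewrite mulr1 -EFinM -expRD mulrBl mul1r.
    by rewrite integral_expR_itvNyc ?subr_gt0// mulr0 expR0 div1r.
  + exact: low_weight_ge0.
  + exact: measurable_low_weight.
- exact: low_weight_ge0.
- exact: measurable_low_weight.
Qed.

Let phi_ge0 s : 0 <= phi s.
Proof. by rewrite lee_fin mulr_ge0 ?expR_ge0// ltW. Qed.

Let measurable_phi : measurable_fun setT phi.
Proof.
by apply/measurable_EFinP; apply: measurable_funM => //; exact: measurable_expRM.
Qed.

Let low_weight_layer_cake (x : R) :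
  \int[leb]_s (phi s * \d_x `[s, 0%R]) =
  (expR (b * x) * \1_(`]-oo, 0%R]) x)%:E.
Proof.
have [x0|x0] := leP x 0%R; last first.
  rewrite indicE memNset ?mulr0; last by rewrite /= in_itv/= leNgt x0.
  apply: integral0_eq => s _; rewrite diracE memNset ?mule0//.
  by rewrite /= in_itv/= [(x <= 0)%R]leNgt x0 andbF.
rewrite indicE mem_set ?mulr1; last by rewrite /= in_itv.
transitivity (\int[leb]_(s in `]-oo, x]) (b%:E * (expR (b * s))%:E)).
  rewrite [RHS]integral_mkcond; apply: eq_integral => s _.
  rewrite patchE diracE; have [sx|xs] := leP s x.
    by rewrite !mem_set ?mule1//= in_itv//= sx.
  by rewrite !memNset ?mule0//= in_itv/= leNgt xs.
rewrite ge0_integralZl//=; last 2 first.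
- by apply/measurable_EFinP; exact: measurable_expRM.
- by rewrite lee_fin ltW.
by rewrite integral_expR_itvNyc// -EFinM mulrCA mulfV ?gt_eqF// mulr1.
Qed.

Let N_ge0 s w : 0 <= N s w. Proof. exact: atom_count_ge0. Qed.

Lemma low_sumE w : low_sum b (xi ^~ w) = \int[leb]_s (phi s * N s w).
Proof.
transitivity (\int[leb]_s (\sum_(i <oo) (phi s * \d_(xi i w) `[s, 0%R]))).
  rewrite integral_nneseries//.
  - by apply: eq_eseriesr => i _; rewrite low_weight_layer_cake.
  - move=> i; apply: emeasurable_funM; first exact: measurable_phi.
    rewrite (_ : (fun s => _) = EFin \o
      \1_[set s : R | (s <= xi i w)%R && (xi i w <= 0)%R]).
      apply/measurable_EFinP; apply: measurable_indic.
      case: (xi i w <= 0)%R.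
        rewrite (_ : [set s | _] = `]-oo, xi i w]%classic)//.
        by apply/seteqP; split => s /=; rewrite in_itv/= andbT.
      rewrite (_ : [set s | _] = set0)//.
      by apply/seteqP; split => s //=; rewrite andbF.
    by apply/funext => s; rewrite diracE /= indicE; congr (_%:R%:E).
  - by move=> i s _; rewrite mule_ge0// phi_ge0.
by apply: eq_integral => s _; rewrite nneseriesZl.
Qed.

Let NN (p : measurableTypeR R * T) := N p.1 p.2.

Let measurable_NN : measurable_fun setT NN.
Proof.
apply: ge0_emeasurable_sum => [k x _ _|k _]; first exact: measure_ge0.
pose E := [set p : measurableTypeR R * T | (p.1 <= xi k p.2)%R && (xi k p.2 <= 0)%R].
rewrite (_ : (fun p => _) = EFin \o \1_E).
  apply/measurable_EFinP; apply: measurable_indic.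
  have mx : measurable_fun setT (fun p : measurableTypeR R * T => xi k p.2).
    exact: measurableT_comp.
  have -> : E =
      (fun p : measurableTypeR R * T => (p.1 - xi k p.2)%R) @^-1` `]-oo, 0%R] `&`
      (fun p : measurableTypeR R * T => xi k p.2) @^-1` `]-oo, 0%R].
    apply/seteqP; split => p; rewrite /E/= !in_itv/= subr_le0.
      by move/andP.
    by move=> [-> ->].
  apply: measurableI; rewrite -[X in measurable X]setTI.
    by apply: measurable_funB => //; exact: measurable_fst.
  exact: mx.
by apply/funext => s; rewrite diracE /= indicE; congr (_%:R%:E).
Qed.

Let lam_le (s : R) : lam s <= (expR (- s))%:E.
Proof.
rewrite -rem_intensity_itvcy; apply: le_measure; rewrite ?inE//.
by apply: subset_itvl; rewrite bnd_simp.
Qed.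

Let lam_fin (s : R) : lam s \is a fin_num.
Proof. by rewrite ge0_fin_numE ?(le_lt_trans (lam_le s)) ?ltry. Qed.

Let lamE s : lam s = \int[P]_w N s w.
Proof. by rewrite (mean_atom_count hxi). Qed.

Let measurable_lam : measurable_fun setT lam.
Proof.
rewrite (_ : lam = fun s => \int[P]_w NN (s, w)).
  apply: (measurable_fun_fubini_tonelli_F NN) => // p; exact: N_ge0.
by apply/funext => s; rewrite lamE.
Qed.

(** Instead of evaluating [lam], exchange the two integrals: the left-hand side
    is the expectation of [low_sum]. *)
Let integral_lam : \int[leb]_s (phi s * lam s) = ((b - 1)^-1)%:E.
Proof.
rewrite -(mean_low_sum b1).
under [RHS]eq_integral do rewrite low_sumE.
rewrite -(fubini_tonelli (m1 := leb) (m2 := P)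
  (fun p : measurableTypeR R * T => phi p.1 * NN p)).
- apply: eq_integral => s _; rewrite lamE -ge0_integralZl//.
  exact: measurable_atom_count.
- apply: emeasurable_funM; last exact: measurable_NN.
  by apply: measurableT_comp => //; exact: measurable_phi.
- by move=> p; rewrite mule_ge0 ?phi_ge0 ?N_ge0.
Qed.

Let phi_dev (p : measurableTypeR R * T) := phi p.1 * `|NN p - lam p.1|.

Let phi_dev_ge0 p : 0 <= phi_dev p.
Proof. by rewrite mule_ge0 ?phi_ge0 ?abse_ge0. Qed.

Let measurable_dev :
  measurable_fun setT (fun p : measurableTypeR R * T => `|NN p - lam p.1|).
Proof.
apply: measurableT_comp => //; apply: emeasurable_funB; first exact: measurable_NN.
by apply: measurableT_comp => //; exact: measurable_lam.
Qed.

Let measurable_phi_dev : measurable_fun setT phi_dev.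
Proof.
apply: emeasurable_funM; last exact: measurable_dev.
by apply: measurableT_comp => //; exact: measurable_phi.
Qed.

Lemma measurable_low_deviation : measurable_fun setT low_deviation.
Proof. exact: (measurable_fun_fubini_tonelli_G phi_dev). Qed.

Lemma low_deviation_ge0 w : 0 <= low_deviation w.
Proof. by apply: integral_ge0 => s _; exact: (phi_dev_ge0 (s, w)). Qed.

Let measurable_section w : measurable_fun setT (fun s => `|N s w - lam s|).
Proof. exact: (measurableT_comp measurable_dev (pair2_measurable w)). Qed.

Let measurable_N w : measurable_fun setT (fun s => N s w).
Proof. exact: (measurableT_comp measurable_NN (pair2_measurable w)). Qed.

Lemma low_sum_le w : low_sum b (xi ^~ w) <= ((b - 1)^-1)%:E + low_deviation w.
Proof.
rewrite low_sumE -integral_lam /low_deviation -ge0_integralD//.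
- apply: ge0_le_integral => //.
  + by move=> s _; rewrite mule_ge0 ?phi_ge0 ?N_ge0.
  + by apply: emeasurable_funM; [exact: measurable_phi|exact: measurable_N].
  + by apply: emeasurable_funD; apply: emeasurable_funM;
      first [exact: measurable_phi|exact: measurable_lam|exact: measurable_section].
  + move=> s _; rewrite -ge0_muleDr ?abse_ge0//.
    by rewrite lee_wpmul2l ?phi_ge0// lee_add_abse_sub ?lam_fin ?N_ge0.
- by move=> s _; rewrite mule_ge0 ?phi_ge0.
- by apply: emeasurable_funM; [exact: measurable_phi|exact: measurable_lam].
- by move=> s _; rewrite mule_ge0 ?phi_ge0.
- by apply: emeasurable_funM; [exact: measurable_phi|exact: measurable_section].
Qed.

Lemma low_sum_ge w : ((b - 1)^-1)%:E <= low_sum b (xi ^~ w) + low_deviation w.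
Proof.
rewrite low_sumE -integral_lam /low_deviation -ge0_integralD//.
- apply: ge0_le_integral => //.
  + by move=> s _; rewrite mule_ge0 ?phi_ge0.
  + by apply: emeasurable_funM; [exact: measurable_phi|exact: measurable_lam].
  + by apply: emeasurable_funD; apply: emeasurable_funM;
      first [exact: measurable_phi|exact: measurable_N|exact: measurable_section].
  + move=> s _; rewrite -ge0_muleDr ?abse_ge0 ?N_ge0//.
    by rewrite lee_wpmul2l ?phi_ge0// lee_add_abse_subC ?lam_fin ?N_ge0.
- by move=> s _; rewrite mule_ge0 ?phi_ge0 ?N_ge0.
- by apply: emeasurable_funM; [exact: measurable_phi|exact: measurable_N].
- by move=> s _; rewrite mule_ge0 ?phi_ge0.
- by apply: emeasurable_funM; [exact: measurable_phi|exact: measurable_section].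
Qed.

(** The choice [c = expR (- s / 2)] in [poisson_deviation] balances the two terms,
    because [lam s <= expR (- s)]. *)
Let count_deviation s : \int[P]_w `|N s w - lam s| <= (2 * expR (- s / 2))%:E.
Proof.
have l0 : 0 <= lam s by [].
have fl := lam_fin s.
have mN : measurable_fun setT (N s) by exact: measurable_atom_count.
have f0 : (0 <= fine (lam s))%R by rewrite fine_ge0.
have NP k : P [set w | N s w = k%:R%:E] = poisson_prob (fine (lam s)) 0%N [set k].
  by case: hxi => + _ _; apply => //; rewrite fineK.
have := poisson_deviation f0 mN NP (expR_gt0 (- s / 2)).
rewrite fineK// => /le_trans; apply; rewrite lee_fin mulr_natl mulr2n lerD2l.
by rewrite ler_pdivrMr ?expR_gt0// -expRD -splitr -lee_fin fineK.
Qed.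

(** The weight [phi s] is of order [expR s] and the deviation of the count of order
    [expR (- s / 2)], so that the integral over the negative half-line converges
    uniformly in [b]. *)
Lemma mean_low_deviation : \int[P]_w low_deviation w <= 4%:E.
Proof.
rewrite -(fubini_tonelli (m1 := leb) (m2 := P) phi_dev)//.
have lam0 s : (0 < s)%R -> `[s, 0%R]%classic = set0 :> set R.
  by move=> s0; rewrite set_itv_ge// bnd_simp -ltNge.
apply: (@le_trans _ _ (\int[leb]_(s in `]-oo, 0%R])
    ((2 * b)%:E * (expR ((b - 2^-1) * s))%:E))).
  rewrite [leRHS]integral_mkcond; apply: ge0_le_integral => //.
  - by move=> s _; apply: integral_ge0 => w _; exact: (phi_dev_ge0 (s, w)).
  - exact: (measurable_fun_fubini_tonelli_F phi_dev).
  - apply/(measurable_restrictT _ _).1 => //.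
    by apply/measurable_EFinP; apply: measurable_funM => //; exact: measurable_expRM.
  move=> s _; rewrite patchE; case: ifPn => [_|]; last first.
    rewrite notin_setE/= in_itv/= => /negP; rewrite -ltNge => s0.
    rewrite integral0_eq// => w _; rewrite /phi_dev /NN /N /lam/= lam0//.
    by rewrite measure0 /atom_count eseries0 ?subee ?abse0 ?mule0.
  rewrite [leLHS](_ : _ = \int[P]_w (phi s * `|N s w - lam s|))//.
  rewrite ge0_integralZl//; last first.
    exact: (measurableT_comp measurable_dev (pair1_measurable s)).
  apply: (le_trans (lee_wpmul2l (phi_ge0 s) (count_deviation s))).
  rewrite -!EFinM lee_fin mulrACA [(b * 2)%R]mulrC -expRD.
  by rewrite (_ : b * s + - s / 2 = (b - 2^-1) * s)%R//; field.
rewrite ge0_integralZl//; last 2 first.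
- by apply/measurable_EFinP; exact: measurable_expRM.
- by rewrite lee_fin mulr_ge0// ltW.
have b2 : (0 < b - 2^-1)%R by move: b1; lra.
rewrite integral_expR_itvNyc// mulr0 expR0 -EFinM lee_fin mulrA mulr1.
by rewrite ler_pdivrMr//; move: b1; lra.
Qed.

End fluctuation.
(** * Share of an atom in the total weight *)

(** In this section [a] is the weight of a high atom, [r] the sum over the low
    atoms, which is within [z] of [e^-1], and [a / (e^-1 + a)] the averaged share
    of the atom. *)
Section averaged_share_algebra.
Context {R : realFieldType}.
Implicit Types a e r w z p q : R.

Lemma averaged_share_le_linear e a : 0 < e -> 0 <= a -> a / (e^-1 + a) <= e * a.
Proof.
move=> e0 a0; have k0 : 0 < e^-1 by rewrite invr_gt0.
rewrite ler_pdivrMr ?ltr_pwDl// mulrAC ler_peMl// mulrDr mulfV ?gt_eqF//.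
by rewrite lerDl mulr_ge0// ltW.
Qed.

(** The difference between [a / (r + a)] and the averaged share is
    [a * (e^-1 - r)] over [(r + a) * (e^-1 + a)], hence at most [z * e]. The
    statement is multiplied out to allow [r + a = 0]. *)
Lemma le_averaged_share e r a z : 0 < e -> 0 <= r -> 0 <= a -> 0 <= z ->
  e^-1 <= r + z -> a <= (r + a) * (a / (e^-1 + a) + e * z).
Proof.
move=> e0 r0 a0 z0 erz; have k0 : 0 < e^-1 by rewrite invr_gt0.
have D0 : 0 < e^-1 + a by rewrite ltr_pwDl.
set g := a / _; have g0 : 0 <= g by rewrite divr_ge0// ltW.
have gD : g * (e^-1 + a) = a by rewrite divfK// gt_eqF.
have ge : g <= e * a by exact: averaged_share_le_linear.
have h1 : 0 <= g * (r + z - e^-1) by rewrite mulr_ge0// subr_ge0.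
have h2 : 0 <= z * (e * a - g) by rewrite mulr_ge0// subr_ge0.
have h3 : 0 <= r * (e * z) by rewrite !mulr_ge0// ltW.
by move: gD h1 h2 h3; nra.
Qed.

(** Here [a] and [q] are the weights of the highest atom at [b] and [b'],
    [w] is the weight of the other high atoms, and [r'] the sum over the low
    atoms at [b']. Passing from the averaged share to the share
    [u = a / (r + a + w)] costs [e * (z + w)]; multiplying [u] by [p = q / s']
    costs [(1 - p) * u], where [u] is at most [e * a + e * z] and
    [(1 - p) * a <= w + r']. *)
Lemma averaged_share_le e r a w z r' s' q : 0 < e -> 0 <= r -> 0 < a -> 0 <= w ->
    0 <= z -> 0 <= r' -> e^-1 <= r + z -> r <= e^-1 + z -> 0 < q -> q <= s' ->
    a * (s' - q) <= q * (w + r') ->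
  a / (e^-1 + a) <= (a * q) / ((r + a + w) * s') + e * (w *+ 2 + z *+ 2 + r').
Proof.
move=> e0 r0 a0 w0 z0 r'0 erz rez q0 qs' aq; have k0 : 0 < e^-1 by rewrite invr_gt0.
have D0 : 0 < e^-1 + a by rewrite addr_gt0.
have S0 : 0 < r + a + w by rewrite ltr_wpDr// ltr_wpDl.
have s0 : 0 < s' by exact: lt_le_trans qs'.
have ua := le_averaged_share e0 r0 (ltW a0) z0 erz.
have ga := averaged_share_le_linear e0 (ltW a0).
set g := a / (e^-1 + a) in ua ga *.
have g0 : 0 <= g by rewrite divr_ge0// ltW.
have gD : g * (e^-1 + a) = a by rewrite divfK// gt_eqF.
pose p := q / s'; pose u := a / (r + a + w).
have -> : (a * q) / ((r + a + w) * s') = p * u.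
  by rewrite /p /u; field; rewrite !gt_eqF.
have p0 : 0 <= p by rewrite divr_ge0// ltW.
have p1 : p <= 1 by rewrite ler_pdivrMr// mul1r.
have pS : p * s' = q by rewrite divfK// gt_eqF.
have uS : u * (r + a + w) = a by rewrite divfK// gt_eqF.
have u0 : 0 <= u by rewrite divr_ge0// ltW.
have u1 : u <= 1.
  by rewrite ler_pdivrMr// mul1r -addrA [r + _]addrC -addrA lerDl addr_ge0.
have gu : g - u <= e * (z + w).
  have -> : g - u = u * (r + w - e^-1) / (e^-1 + a).
    apply: (mulIf (lt0r_neq0 D0)); rewrite divfK ?gt_eqF// mulrBl gD.
    by rewrite -{1}uS; ring.
  rewrite ler_pdivrMr//; apply: (@le_trans _ _ (z + w)).
    apply: (@le_trans _ _ (u * (z + w))); first by rewrite ler_wpM2l//; lra.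
    by rewrite ler_piMl// addr_ge0.
  rewrite mulrAC ler_peMl ?addr_ge0// mulrDr mulfV ?gt_eqF//.
  by rewrite lerDl mulr_ge0// ltW.
have ug : u <= g + e * z.
  have gz : 0 <= g + e * z by rewrite addr_ge0// mulr_ge0// ltW.
  rewrite ler_pdivrMr// mulrC (le_trans ua)// ler_wpM2r//.
  by rewrite lerDl.
have pa : (1 - p) * a <= w + r'.
  have : a * ((1 - p) * s') <= (p * (w + r')) * s'.
    by rewrite mulrBl mul1r pS -mulrA [X in p * X]mulrC mulrA pS.
  rewrite mulrA ler_pM2r// mulrC => /le_trans; apply.
  by rewrite ler_piMl// addr_ge0.
have h1 : (1 - p) * u <= (1 - p) * (g + e * z) by rewrite ler_wpM2l// subr_ge0.
have h2 : (1 - p) * g <= (1 - p) * (e * a) by rewrite ler_wpM2l// subr_ge0.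
have h3 : e * ((1 - p) * a) <= e * (w + r') by rewrite ler_pM2l.
have h4 : (1 - p) * (e * z) <= e * z by rewrite ler_piMl ?mulr_ge0 ?(ltW e0)// gerBl.
by move: h1 h2 h3 h4 gu; nra.
Qed.

End averaged_share_algebra.
(** * Pathwise bounds on the overlap *)

(** The share of the weight of an atom at [y], when the sum over the low atoms is
    replaced by its mean [(b - 1)^-1]. *)
Definition averaged_share {R : realType} (b y : R) : R :=
  expR (b * y) / ((b - 1)^-1 + expR (b * y)).

Definition high_sum {R : realType} (b : R) (x : nat -> R) : \bar R :=
  (\sum_(i <oo) (averaged_share b (x i) * \1_(`]0, +oo[) (x i))%:E)%E.

(** A bound on the weight of the high atoms other than the highest one: an atom
    in [(k, k + 1]] has weight at most [expR (b * (k + 1))], and the number of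
    atoms above [k] other than the highest one is the excess over 1 of the number
    of atoms above [k]. *)
Definition excess_sum {R : realType} {T : Type} (xi : nat -> T -> R) (b : R)
    (w : T) : \bar R :=
  (\sum_(k <oo) (expR (b * k.+1%:R))%:E *
    maxe (atom_count xi w `]k%:R, +oo[ - 1) 0)%E.

Section indicators.
Context {R : realType}.

Lemma indic_low (y : R) : \1_(`]-oo, 0]) y = (y <= 0)%R%:R :> R.
Proof. by rewrite indicE mem_setE in_itv. Qed.

Lemma indic_high (y : R) : \1_(`]0, +oo[) y = (0 < y)%R%:R :> R.
Proof. by rewrite indicE mem_setE in_itv/= andbT. Qed.

Lemma averaged_share_ge0 (b y : R) : 1 < b -> 0 <= averaged_share b y.
Proof. by move=> b1; rewrite divr_ge0 ?addr_ge0 ?expR_ge0// invr_ge0 subr_ge0 ltW. Qed.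

End indicators.

Lemma nneseries_le_term {R : realType} (u : nat -> \bar R) (i : nat) :
  (forall k, 0 <= u k)%E -> (u i <= \sum_(k <oo) u k)%E.
Proof.
by move=> u0; rewrite (nneseriesD1 (n := i))// leeDl// nneseries_ge0.
Qed.

Section pathwise.
Local Open Scope ereal_scope.
Context {R : realType} {T : Type} (xi : nat -> T -> R) (w : T).
Let x i := xi i w.

Lemma finitely_many_high : atom_count xi w `]0%R, +oo[ < +oo ->
  exists n, forall i, (n <= i)%N -> (x i <= 0)%R.
Proof.
rewrite /atom_count => Nfin.
have : cvgn (series (fun i => \1_(`]0%R, +oo[) (x i) : R)).
  apply: nnseries_is_cvg => // i.
move/cvg_series_cvg_0/cvgrPdist_lt => /(_ 1%R ltr01)[n _ xn].
exists n => i ni; have := xn i ni; rewrite sub0r normrN indic_high.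
by case: (leP (x i) 0%R) => // _; rewrite normr_nat ltxx.
Qed.

(** The sum of the weights has infinite expectation; its finiteness comes from the
    finite number of high atoms and the finiteness of the sum over the low ones. *)
Lemma exp_sum_lty (c : R) : atom_count xi w `]0%R, +oo[ < +oo ->
  low_sum c x < +oo -> \sum_(i <oo) (expR (c * x i))%:E < +oo.
Proof.
move=> /finitely_many_high[n xn] lfin.
rewrite (nneseries_split 0%N n)//.
rewrite add0n lte_add_pinfty//; first by rewrite sumEFin ltry.
apply: le_lt_trans lfin; rewrite /low_sum.
rewrite (nneseries_split 0%N n); last first.
  by move=> k _; rewrite lee_fin mulr_ge0 ?expR_ge0.
rewrite add0n (@le_trans _ _
  (\sum_(n <= k <oo) (expR (c * x k) * \1_(`]-oo, 0%R]) (x k))%:E))//.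
  rewrite le_eqVlt; apply/orP; left; apply/eqP.
  rewrite eseries_cond [RHS]eseries_cond; apply: eq_eseriesr => i /andP[_ ni].
  by rewrite indic_low xn// mulr1.
by rewrite leeDr// sume_ge0// => k _; rewrite lee_fin mulr_ge0 ?expR_ge0.
Qed.

Lemma exists_argmax : atom_count xi w `]0%R, +oo[ < +oo ->
  (forall i, (x i <= 0)%R) \/
  exists2 m, (0 < x m)%R & forall i, (x i <= x m)%R.
Proof.
move=> /finitely_many_high[n xn].
have [[i xi0]|] := pselect (exists i, (0 < x i)%R); last first.
  by move=> h; left=> i; rewrite leNgt; apply/negP => xi0; apply: h; exists i.
have ltin : (i < n)%N by rewrite ltnNge; apply/negP => /xn; rewrite leNgt xi0.
right; pose m := [arg max_(j > Ordinal ltin) x (val j)]%O.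
have mP j : (x (val (j : 'I_n)) <= x (val m))%R.
  by rewrite /m; case: arg_maxP => // k _ /(_ j); apply.
have m0 : (0 < x (val m))%R := lt_le_trans xi0 (mP (Ordinal ltin)).
exists (val m) => // j; have [jn|nj] := ltnP j n; first exact: (mP (Ordinal jn)).
exact: le_trans (xn _ nj) (ltW m0).
Qed.

(** Sum over [k] first, that is, exchange the sums over the atoms and over the
    levels. *)
Lemma nonmax_high_sum_le (b : R) (m : nat) : (0 <= b)%R ->
  (forall i, (x i <= x m)%R) ->
  \sum_(i <oo | i != m) (expR (b * x i) * \1_(`]0%R, +oo[) (x i))%:E <=
  excess_sum xi b w.
Proof.
move=> b0 xm.
pose t i k : \bar R := (expR (b * k.+1%:R))%:E * \d_(x i) `]k%:R, +oo[.
have t0 i k : 0 <= t i k by rewrite mule_ge0// lee_fin expR_ge0.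
apply: (@le_trans _ _ (\sum_(i <oo | i != m) \sum_(k <oo) t i k)).
  apply: lee_nneseries => [i _ _|i _]; first by rewrite lee_fin mulr_ge0 ?expR_ge0.
  rewrite indic_high; case: leP => x0; rewrite ?mulr0 ?nneseries_ge0// mulr1.
  (* The least such [k] satisfies [k < x i <= k + 1]. *)
  have /ex_minnP[k xk kmin] : exists k, (x i <= k.+1%:R)%R.
    exists (Num.trunc (x i)); apply: ltW; exact: truncnS_gt.
  apply: le_trans (nneseries_le_term k (t0 i)).
  rewrite /t diracE mem_set ?mule1.
    by rewrite lee_fin ler_expR ler_wpM2l.
  rewrite /= in_itv/= andbT; case: k kmin {xk} => [//|k kmin].
  by rewrite ltNge; apply/negP => /kmin; rewrite ltnn.
rewrite nneseries_interchange//; apply: lee_nneseries => [k _ _|k _].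
  by apply: nneseries_ge0.
rewrite nneseriesZl// lee_wpmul2l ?lee_fin ?expR_ge0//.
have [mk|km] := leP (x m) k%:R.
  rewrite eseries0 ?le_max ?lexx ?orbT// => i _ _.
  rewrite diracE memNset//= in_itv/= andbT; apply/negP.
  by rewrite -leNgt (le_trans (xm i)).
have -> : atom_count xi w `]k%:R, +oo[ =
    1 + \sum_(i <oo | i != m) \d_(x i) `]k%:R, +oo[.
  rewrite /atom_count (nneseriesD1 (n := m))//; congr (_ + _).
  by rewrite diracE mem_set//= in_itv/= km.
by rewrite le_max addeAC subee// add0e lexx.
Qed.

End pathwise.
Lemma rem_overlap_ge0 (R : realType) (T : Type) (xi : nat -> T -> R) (b b' : R)
  (w : T) : 0 <= rem_overlap xi b b' w.
Proof.
by rewrite divr_ge0 ?mulr_ge0// fine_ge0// nneseries_ge0// => i _ _;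
  rewrite lee_fin ?mulr_ge0 ?expR_ge0.
Qed.

(** In this section [S] and [S'] are the total weights at [b] and [b'], and the
    quantity [Z] bounds the distance of the sum over the low atoms to its
    mean. *)
Section overlap_bounds.
Local Open Scope ereal_scope.
Context {R : realType} {T : Type} (xi : nat -> T -> R) (w : T) (b b' : R).
Hypothesis b1 : (1 < b)%R.
Let x i := xi i w.
Hypothesis sum_lty : \sum_(i <oo) (expR (b * x i))%:E < +oo.
Hypothesis sum'_lty : \sum_(i <oo) (expR (b' * x i))%:E < +oo.

Let S := fine (\sum_(i <oo) (expR (b * x i))%:E).
Let S' := fine (\sum_(i <oo) (expR (b' * x i))%:E).
Let Q := rem_overlap xi b b' w.

Let eS : \sum_(i <oo) (expR (b * x i))%:E = S%:E.
Proof.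
by rewrite fineK// ge0_fin_numE// nneseries_ge0// => i _ _; rewrite lee_fin expR_ge0.
Qed.

Let eS' : \sum_(i <oo) (expR (b' * x i))%:E = S'%:E.
Proof.
by rewrite fineK// ge0_fin_numE// nneseries_ge0// => i _ _; rewrite lee_fin expR_ge0.
Qed.

Let le_S i : (expR (b * x i) <= S)%R.
Proof.
rewrite -lee_fin -eS; apply: (nneseries_le_term i) => k.
by rewrite lee_fin expR_ge0.
Qed.

Let le_S' i : (expR (b' * x i) <= S')%R.
Proof.
rewrite -lee_fin -eS'; apply: (nneseries_le_term i) => k.
by rewrite lee_fin expR_ge0.
Qed.

Let S_ge0 : (0 <= S)%R. Proof. exact: le_trans (expR_ge0 _) (le_S 0). Qed.
Let S'_ge0 : (0 <= S')%R. Proof. exact: le_trans (expR_ge0 _) (le_S' 0). Qed.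
Let S_gt0 : (0 < S)%R. Proof. exact: lt_le_trans (expR_gt0 _) (le_S 0). Qed.
Let S'_gt0 : (0 < S')%R. Proof. exact: lt_le_trans (expR_gt0 _) (le_S' 0). Qed.

Let U := \sum_(i <oo) (expR (b * x i) * expR (b' * x i))%:E.

Let U_ge0 : 0 <= U.
Proof. by apply: nneseries_ge0 => i _ _; rewrite lee_fin mulr_ge0 ?expR_ge0. Qed.

Let QE : Q = (fine U / (S * S'))%R. Proof. by []. Qed.

Let U_lty : U < +oo.
Proof.
apply: (@le_lt_trans _ _ (S%:E * S'%:E)); last by rewrite -EFinM ltry.
rewrite -eS' -nneseriesZl => [|i _]; last by rewrite lee_fin expR_ge0.
apply: lee_nneseries => [i _ _|i _]; first by rewrite lee_fin mulr_ge0 ?expR_ge0.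
by rewrite -EFinM lee_fin ler_wpM2r ?expR_ge0.
Qed.

Let low_le c : low_sum c x <= \sum_(i <oo) (expR (c * x i))%:E.
Proof.
apply: lee_nneseries => [i _ _|i _]; first exact: low_weight_ge0.
by rewrite lee_fin indic_low ler_piMr ?expR_ge0// lern1 leq_b1.
Qed.

Let low_ge0 c : 0 <= low_sum c x.
Proof. by apply: nneseries_ge0 => i _ _; exact: low_weight_ge0. Qed.

Let e := (b - 1)%R.
Let e_gt0 : (0 < e)%R. Proof. by rewrite subr_gt0. Qed.

Let e_ge0 : (0 <= e)%R. Proof. exact: ltW. Qed.

Let high_weight_ge0 i : 0 <= (averaged_share b (x i) * \1_(`]0%R, +oo[) (x i))%:E.
Proof. by rewrite lee_fin mulr_ge0// averaged_share_ge0. Qed.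

Let low_high_le i r : low_sum b x = r%:E -> (0 < x i)%R ->
  (r + expR (b * x i) <= S)%R.
Proof.
move=> rE xi0; rewrite -lee_fin EFinD -eS -rE /low_sum.
rewrite [leRHS](nneseriesD1 (n := i))// addeC leeD2l//.
rewrite [leLHS](nneseriesD1 (n := i))//.
rewrite indic_low [(x i <= 0)%R]leNgt xi0 mulr0 add0e.
apply: lee_nneseries => [k _ _|k _]; first exact: low_weight_ge0.
by rewrite lee_fin indic_low ler_piMr ?expR_ge0// lern1 leq_b1.
Qed.

(** Termwise, [a * a' <= S * S' * averaged_share + S * (e + e * Z) * a'], with the
    first term on the right only for high atoms. For high atoms this uses
    [a' <= S'] and [le_averaged_share]; for low atoms, that [a <= 1] and that [a]
    is at most the sum over the low atoms. *)
Lemma overlap_le (Z : \bar R) : 0 <= Z -> (e^-1)%:E <= low_sum b x + Z ->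
  Q%:E <= high_sum b x + e%:E + e%:E * Z.
Proof.
have high_ge0 : 0 <= high_sum b x by exact: nneseries_ge0.
have [r rE] : exists r, low_sum b x = r%:E.
  exists (fine (low_sum b x)); rewrite fineK// ge0_fin_numE//.
  exact: le_lt_trans (low_le b) sum_lty.
have r0 : (0 <= r)%R by rewrite -lee_fin -rE.
have rS : (r <= S)%R by rewrite -lee_fin -rE -eS.
case: Z => [z| |//] z0; last first.
  move=> _; rewrite gt0_muley ?lte_fin// addey ?leey//.
  by rewrite -ltNye (lt_le_trans ltNy0)// adde_ge0// lee_fin ltW.
rewrite rE -EFinD !lee_fin in z0 * => erz.
case hE : (high_sum b x) => [h| |]; last by rewrite hE in high_ge0.
  2: by rewrite leey.
rewrite -EFinM -!EFinD lee_fin QE ler_pdivrMr ?mulr_gt0//.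
rewrite -lee_fin fineK ?ge0_fin_numE//.
apply: (@le_trans _ _ (\sum_(i <oo)
  ((S * S')%:E * (averaged_share b (x i) * \1_(`]0%R, +oo[) (x i))%:E +
   (S * (e + e * z))%:E * (expR (b' * x i))%:E))); last first.
  have c0 : (0 <= S * (e + e * z))%R.
    by rewrite mulr_ge0// addr_ge0// mulr_ge0.
  rewrite nneseriesD => [|i _ _|i _ _]; last 2 first.
  - by rewrite mule_ge0// lee_fin mulr_ge0.
  - by rewrite mule_ge0// lee_fin ?expR_ge0.
  rewrite !nneseriesZl//.
  rewrite -/(high_sum b x) hE eS' -!EFinM -EFinD lee_fin.
  by rewrite le_eqVlt; apply/orP; left; apply/eqP; ring.
apply: lee_nneseries => [i _ _|i _]; first by rewrite lee_fin mulr_ge0 ?expR_ge0.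
rewrite -!EFinM -EFinD lee_fin.
set a := expR (b * x i); set a' := expR (b' * x i).
have a0 : (0 <= a)%R by exact: expR_ge0.
have a'0 : (0 <= a')%R by exact: expR_ge0.
have a'S : (a' <= S')%R by exact: le_S'.
have [xi0|xi0] := leP (x i) 0%R.
  rewrite indic_high ltNge xi0 !mulr0 add0r ler_wpM2r//.
  have a1 : (a <= 1)%R by rewrite -expR0 ler_expR pmulr_rle0// (lt_trans _ b1).
  have ar : (a <= r)%R.
    rewrite -lee_fin -rE.
    apply: le_trans (nneseries_le_term i (fun k => low_weight_ge0 b (x k))).
    by rewrite lee_fin indic_low xi0 mulr1.
  have h1 : (1 <= e * (r + z))%R by rewrite mulrC -ler_pdivrMr// div1r.
  have h2 : (r * (e + e * z) <= S * (e + e * z))%R.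
    by rewrite ler_wpM2r// addr_ge0// mulr_ge0.
  apply: le_trans h2.
  have h3 : (0 <= e * (r - a))%R by rewrite mulr_ge0// subr_ge0.
  have h4 : (0 <= a * (e * (r + z) - 1))%R by rewrite mulr_ge0// subr_ge0.
  have h5 : (0 <= e * z * (r - a))%R.
    by apply: mulr_ge0; [exact: mulr_ge0|rewrite subr_ge0].
  have h6 : (0 <= e * r * (1 - a))%R.
    by apply: mulr_ge0; [exact: mulr_ge0|rewrite subr_ge0].
  by move: h3 h4 h5 h6; nra.
rewrite indic_high xi0 mulr1.
have g0 : (0 <= averaged_share b (x i))%R by exact: averaged_share_ge0.
have h1 := le_averaged_share e_gt0 r0 a0 z0 erz.
have h2 : (a <= S * (averaged_share b (x i) + e * z))%R.
  apply: (le_trans h1); apply: ler_wpM2r.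
    by apply: addr_ge0; [exact: g0|exact: mulr_ge0].
  exact: low_high_le rE xi0.
have h3 : (a * a' <= S * (averaged_share b (x i) + e * z) * a')%R by rewrite ler_wpM2r.
have h4 : (0 <= S * averaged_share b (x i) * (S' - a'))%R.
  by apply: mulr_ge0; [exact: mulr_ge0|rewrite subr_ge0].
have h5 : (0 <= S * e * a')%R by rewrite !mulr_ge0.
by move: h3 h4 h5; nra.
Qed.

(** Only the highest atom [m] is kept in the overlap, see [averaged_share_le]. Its
    hypothesis on the weights holds because, [x m] being the largest, passing
    from [b] to [b'] favours [m] over the other high atoms, and because
    the weight of [m] at [b] is at most its weight at [b']. *)
Lemma overlap_ge (Z : \bar R) : (b <= b')%R -> 0 <= Z ->
    low_sum b x <= (e^-1)%:E + Z -> (e^-1)%:E <= low_sum b x + Z ->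
    atom_count xi w `]0%R, +oo[ < +oo ->
  high_sum b x <=
  Q%:E + e%:E * (3%:E * excess_sum xi b w + 2%:E * Z + low_sum b' x).
Proof.
move=> bb' Z0 lowle lowge Nfin.
have bgt0 : (0 < b)%R by exact: lt_trans b1.
have W0 : 0 <= excess_sum xi b w.
  apply: nneseries_ge0 => k _ _.
  by rewrite mule_ge0 ?lee_fin ?expR_ge0// le_max lexx orbT.
have Q0 : (0 <= Q)%R by exact: rem_overlap_ge0.
have [xle0|[m m0 xm]] := exists_argmax Nfin.
  rewrite /high_sum eseries0 => [|i _ _].
    by rewrite adde_ge0 ?lee_fin// mule_ge0// ?lee_fin// !adde_ge0// mule_ge0.
  by rewrite indic_high ltNge xle0 mulr0.
pose W := \sum_(i <oo | i != m) (expR (b * x i) * \1_(`]0%R, +oo[) (x i))%:E.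
have hi0 i : 0 <= (expR (b * x i) * \1_(`]0%R, +oo[) (x i))%:E.
  by rewrite lee_fin mulr_ge0 ?expR_ge0.
have Wle : W <= excess_sum xi b w by exact: nonmax_high_sum_le (ltW bgt0) xm.
apply: (@le_trans _ _ (Q%:E + e%:E * (3%:E * W + 2%:E * Z + low_sum b' x))); last first.
  by rewrite leeD2l// lee_wpmul2l// leeD2r// leeD2r// lee_wpmul2l.
have exp0 c i : 0 <= (expR (c * x i))%:E by rewrite lee_fin expR_ge0.
have low0 c i := low_weight_ge0 c (x i).
have WS : W <= S%:E.
  rewrite -eS (nneseriesD1 (n := m))//; apply: le_trans (leeDr _ _) => //.
  apply: lee_nneseries => // i _; rewrite lee_fin indic_high.
  by rewrite ler_piMr ?expR_ge0// lern1 leq_b1.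
have [w0 wE] : exists v, W = v%:E.
  exists (fine W); rewrite fineK// ge0_fin_numE ?(le_lt_trans WS) ?ltry//.
  exact: nneseries_ge0.
have [r rE] : exists v, low_sum b x = v%:E.
  exists (fine (low_sum b x)); rewrite fineK// ge0_fin_numE//.
  exact: le_lt_trans (low_le b) sum_lty.
have [r' r'E] : exists v, low_sum b' x = v%:E.
  exists (fine (low_sum b' x)); rewrite fineK// ge0_fin_numE//.
  exact: le_lt_trans (low_le b') sum'_lty.
have low_nonmax c :
    \sum_(i <oo | i != m) (expR (c * x i) * \1_(`]-oo, 0%R]) (x i))%:E =
    low_sum c x.
  rewrite /low_sum [RHS](nneseriesD1 (n := m))//.
  by rewrite indic_low [(x m <= 0)%R]leNgt m0 mulr0 add0e.
case: Z Z0 lowle lowge => [z| |//] z0; last first.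
  move=> _ _; rewrite wE r'E gt0_muley ?lte_fin// -EFinM addey// addye//.
  by rewrite gt0_muley ?lte_fin// addey// leey.
rewrite rE -!EFinD !lee_fin => rez erz; rewrite lee_fin in z0.
have w00 : (0 <= w0)%R by rewrite -lee_fin -wE; exact: nneseries_ge0.
have r0 : (0 <= r)%R by rewrite -lee_fin -rE.
have r'0 : (0 <= r')%R by rewrite -lee_fin -r'E.
pose a := expR (b * x m); pose q := expR (b' * x m).
have SE : S = (r + a + w0)%R.
  apply: EFin_inj; rewrite !EFinD -eS -rE -wE -low_nonmax (nneseriesD1 (n := m))//.
  rewrite [RHS]addeAC [RHS]addeC; congr (_ + _); rewrite -nneseriesD//.
  apply: eq_eseriesr => i _; rewrite -EFinD -mulrDr indic_low indic_high.
  by case: leP; rewrite ?addr0 ?add0r mulr1.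
have share : (a * (S' - q) <= q * (w0 + r'))%R.
  rewrite mulrBr lerBlDr -lee_fin EFinM -eS' (nneseriesD1 (n := m))//.
  rewrite ge0_muleDr// ?nneseries_ge0// addeC -EFinM -/q EFinD leeD2r//.
  rewrite EFinM EFinD -wE -r'E -low_nonmax -nneseriesD// -!nneseriesZl//; last first.
    by move=> i _; exact: adde_ge0.
  apply: lee_nneseries => [i _ _|i im]; first by rewrite mule_ge0// lee_fin expR_ge0.
  rewrite -EFinD -!EFinM lee_fin indic_low indic_high /a /q.
  have [xi0|xi0] := leP (x i) 0%R.
    rewrite mulr0 add0r mulr1 ler_wpM2r ?expR_ge0// ler_expR.
    by rewrite ler_wpM2r// ltW.
  rewrite mulr0 addr0 mulr1 -!expRD ler_expR -subr_ge0.
  rewrite (_ : (_ - _ = (b' - b) * (x m - x i))%R); last by ring.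
  by apply: mulr_ge0; rewrite subr_ge0; [exact: bb'|exact: xm].
have main := averaged_share_le e_gt0 r0 (expR_gt0 (b * x m)) w00 z0 r'0 erz rez
  (expR_gt0 (b' * x m)) (le_S' m) share.
apply: (@le_trans _ _ ((averaged_share b (x m))%:E + e%:E * W)).
  rewrite /high_sum (nneseriesD1 (n := m))//.
  rewrite indic_high m0 mulr1 leeD2l// -nneseriesZl//.
  apply: lee_nneseries => // i _; rewrite -EFinM lee_fin indic_high mulrA.
  by rewrite ler_wpM2r// averaged_share_le_linear ?expR_ge0.
rewrite wE r'E !(=^~ EFinM, =^~ EFinD) lee_fin.
have QU : ((a * q) / ((r + a + w0) * S') <= Q)%R.
  rewrite QE -SE ler_pM2r ?invr_gt0 ?mulr_gt0// -lee_fin fineK ?ge0_fin_numE//.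
  apply: (nneseries_le_term (u := fun i => (expR (b * x i) * expR (b' * x i))%:E) m).
  by move=> k; rewrite lee_fin mulr_ge0 ?expR_ge0.
by move: main QU; rewrite /averaged_share -/e -/a -/q !mulr2n; nra.
Qed.

End overlap_bounds.
(** * Mean of the sum over the high atoms *)

Section mean_high_sum.
Context {R : realType} (b : R).
Local Notation leb := (@lebesgue_measure R).
Hypothesis b1 : 1 < b.
Let e := b - 1.
Hypothesis e_small : e <= 16^-1.
Let L := ln (1 / e).

Let e_gt0 : 0 < e. Proof. by rewrite subr_gt0. Qed.

Let expRL : expR L = e^-1.
Proof. by rewrite lnK ?posrE div1r// invr_gt0. Qed.

Let expRNL : expR (- L) = e.
Proof. by rewrite expRN expRL invrK. Qed.

Let L_gt0 : 0 < L.
Proof. by rewrite -expR_gt1 expRL invf_gt1//; move: e_small; lra. Qed.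

(** The error [expR (e * L) - 1] is of order [e * L], and [e * L ^+ 2] is bounded
    because [L / 2 <= expR (L / 2)], whose square is [e^-1]. *)
Let eL_le : e * L * expR (e * L) <= e * L + 8 * e.
Proof.
have L2 : e * L ^+ 2 <= 4.
  have h : L / 2 <= expR (L / 2).
    by have := expR_ge1Dx (L / 2); apply: le_trans; rewrite lerDr.
  have : (L / 2) ^+ 2 <= e^-1.
    rewrite -expRL {2}(splitr L) expRD -expr2 ler_sqr ?nnegrE ?expR_ge0//.
    by rewrite divr_ge0// ltW.
  have := mulfV (lt0r_neq0 e_gt0); set k := e^-1 => ek h2.
  have : e * (L / 2) ^+ 2 <= e * k by rewrite ler_pM2l.
  by rewrite ek; nra.
set y := e * L.
have y0 : 0 <= y by rewrite mulr_ge0// ltW.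
(* The range of [e] is chosen for this bound: [y ^+ 2 <= 4 * e <= 1 / 4]. *)
have y2 : y <= 2^-1.
  rewrite -ler_sqr ?nnegrE// /y exprMn.
  by move: L2 e_small e_gt0; rewrite expr2; nra.
have ey : expR y <= 1 + 2 * y.
  have := expR_ge1Dx (- y); rewrite expRN => h.
  have E0 := expR_gt0 y.
  have : (1 - y) * expR y <= 1 by rewrite -ler_pdivlMr// div1r.
  move: E0; set E := expR y => E0 h1.
  by nra.
apply: (@le_trans _ _ (y * (1 + 2 * y))); first by rewrite ler_wpM2l.
by rewrite /y; move: L2 e_gt0; nra.
Qed.

Local Open Scope ereal_scope.

Let J := \int[@rem_intensity R]_x (averaged_share b x * \1_(`]0%R, +oo[) x)%:E.

Lemma measurable_high_weight :
  measurable_fun setT (fun x : R => (averaged_share b x * \1_(`]0%R, +oo[) x)%:E).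
Proof.
apply/measurable_EFinP; apply: measurable_funM; last exact: measurable_indic.
have cE : continuous (fun x : R => expR (b * x)).
  move=> x; apply: continuous_comp; last exact: continuous_expR.
  exact: mulrl_continuous.
apply: continuous_measurable_fun => x; apply: cvgM; first exact: cE.
apply: cvgV; last by apply: cvgD; [exact: cvg_cst|exact: cE].
by rewrite gt_eqF// addr_gt0 ?expR_gt0// invr_gt0.
Qed.

Let high_weight_ge0 (x : R) : 0 <= (averaged_share b x * \1_(`]0%R, +oo[) x)%:E.
Proof. by rewrite lee_fin mulr_ge0// averaged_share_ge0. Qed.

Let JE : J = \int[leb]_x ((averaged_share b x * \1_(`]0%R, +oo[) x) * expR (- x))%:E.
Proof.
by rewrite /J integral_rem_intensity//; exact: measurable_high_weight.
Qed.

Let mJ : measurable_fun setT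
  (fun x : R => ((averaged_share b x * \1_(`]0%R, +oo[) x) * expR (- x))%:E).
Proof.
apply/measurable_EFinP; apply: measurable_funM.
  by apply/measurable_EFinP; exact: measurable_high_weight.
by apply/measurable_EFinP; exact: measurable_expRN.
Qed.

Let lebL (i j : bool) : leb [set` Interval (BSide i 0%R) (BSide j L)] = L%:E.
Proof. by rewrite lebesgue_measure_itv/= lte_fin L_gt0 sube0. Qed.

Let integral_stepL (c : R) : (0 <= c)%R ->
  \int[leb]_x (c * \1_(`]0%R, L]) x)%:E = (c * L)%:E.
Proof.
move=> c0; under eq_integral do rewrite EFinM.
rewrite ge0_integralZl//; last first.
  by apply/measurable_EFinP; exact: measurable_indic.
by rewrite integral_indic// setIT [X in _ * X](lebL false false).
Qed.

(** Up to [L] the averaged share is at most [e * expR (b * x)], which makes the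
    integrand at most [e * expR (e * L)]; beyond [L] it is at most 1. *)
Lemma high_intensity_le : J <= (e * L + 9 * e)%:E.
Proof.
pose c := (e * expR (e * L))%R.
have c0 : (0 <= c)%R by rewrite mulr_ge0 ?expR_ge0// ltW.
apply: (@le_trans _ _ (\int[leb]_x ((c * \1_(`]0%R, L]) x)%:E +
    (expR (- x) * \1_(`[L, +oo[) x)%:E))).
  rewrite JE; apply: ge0_le_integral => //.
  - by move=> x _; rewrite lee_fin mulr_ge0 ?expR_ge0// mulr_ge0// averaged_share_ge0.
  - apply/measurable_EFinP; apply: measurable_funD.
      by apply: measurable_funM => //; exact: measurable_indic.
    apply: measurable_funM; last exact: measurable_indic.
    by apply/measurable_EFinP; exact: measurable_expRN.
  move=> x _; rewrite -EFinD lee_fin !indicE !mem_setE !in_itv/= !andbT.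
  have E0 := expR_gt0 (- x).
  have [x0|x0] := leP x 0%R.
    by rewrite mulr0 mul0r mulr0 add0r mulr_ge0// ltW.
  rewrite mulr1; have sl := averaged_share_le_linear e_gt0 (expR_ge0 (b * x)).
  have [Lx|xL] := leP L x.
    have c1 : (0 <= c * (x <= L)%R%:R)%R by rewrite mulr_ge0.
    rewrite mulr1 -[leLHS]add0r lerD// ler_piMl ?(ltW E0)//.
    rewrite /averaged_share ler_pdivrMr ?addr_gt0 ?invr_gt0 ?expR_gt0// mul1r lerDr.
    by rewrite invr_ge0 ltW.
  rewrite (ltW xL)/= mulr0n mulr1n mulr0 addr0 mulr1.
  apply: (le_trans (ler_wpM2r (ltW E0) sl)).
  rewrite -mulrA -expRD /c ler_pM2l// ler_expR.
  rewrite (_ : (b * x + - x = e * x)%R); last by rewrite /e; ring.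
  by rewrite ler_pM2l// ltW.
rewrite ge0_integralD//; last 3 first.
- by move=> x _; rewrite lee_fin mulr_ge0.
- by apply/measurable_EFinP; apply: measurable_funM => //; exact: measurable_indic.
- apply/measurable_EFinP; apply: measurable_funM; last exact: measurable_indic.
  by apply/measurable_EFinP; exact: measurable_expRN.
rewrite integral_stepL//.
rewrite [X in _ + X](_ : _ = rem_intensity `[L, +oo[); last first.
  rewrite /rem_intensity [RHS]integral_mkcond; apply: eq_integral => x _.
  by rewrite patchE indicE; case: ifPn => _; rewrite ?mulr1 ?mulr0.
rewrite rem_intensity_itvcy expRNL -EFinD lee_fin /c.
by move: eL_le; nra.
Qed.

(** Up to [L] the integrand is at least [e - e ^+ 2 * expR x], and
    [e ^+ 2 * expR x] has integral [e] over the half-line up to [L]. *)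
Lemma high_intensity_ge : (e * L)%:E <= J + e%:E.
Proof.
have -> : e%:E = \int[leb]_(x in `]-oo, L]) ((e ^+ 2)%:E * (expR (1 * x))%:E).
  rewrite ge0_integralZl//; last 2 first.
  - by apply/measurable_EFinP; exact: measurable_expRM.
  - by rewrite lee_fin sqr_ge0.
  rewrite integral_expR_itvNyc// mul1r divr1 expRL -EFinM; congr EFin.
  by rewrite expr2 -mulrA mulfV ?mulr1// gt_eqF.
rewrite [X in _ + X]integral_mkcond JE -ge0_integralD//; last 3 first.
- by move=> x _; rewrite lee_fin mulr_ge0 ?expR_ge0// mulr_ge0// averaged_share_ge0.
- move=> x _; rewrite patchE; case: ifPn => // _.
  by rewrite -EFinM lee_fin mulr_ge0 ?sqr_ge0 ?expR_ge0.
- apply/(measurable_restrictT _ _).1 => //.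
  by apply/measurable_EFinP; apply: measurable_funM => //; exact: measurable_expRM.
rewrite -integral_stepL; last exact: ltW.
have me2 : measurable_fun setT
    ((fun x : R => (e ^+ 2)%:E * (expR (1 * x))%:E) \_ `]-oo, L]).
  apply/(measurable_restrictT _ _).1 => //.
  by apply/measurable_EFinP; apply: measurable_funM => //; exact: measurable_expRM.
apply: ge0_le_integral => //.
- by move=> x _; rewrite lee_fin mulr_ge0// ltW.
- by apply/measurable_EFinP; apply: measurable_funM => //; exact: measurable_indic.
- exact: emeasurable_funD.
move=> x _; rewrite patchE !indicE !mem_setE !in_itv/= andbT.
have r0 : (0 <= e ^+ 2 * expR x)%R by rewrite mulr_ge0 ?sqr_ge0 ?expR_ge0.
have t0 := expR_gt0 (- x).
have s0 := averaged_share_ge0 x b1.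
have [x0|x0] /= := leP x 0%R.
  rewrite mulr0 mulr0 mul0r add0e; case: ifPn => // _.
  by rewrite -EFinM lee_fin mul1r.
have [xL|Lx] /= := leP x L; last first.
  by rewrite mulr0 mulr1 adde0 lee_fin mulr_ge0// ltW.
rewrite !mulr1 mul1r -EFinM -EFinD lee_fin expRN -lerBlDr.
have k0 : (0 < e^-1)%R by rewrite invr_gt0.
have ek : (e * e^-1 = 1)%R by rewrite mulfV// gt_eqF.
have tt := expR_gt0 x; set t := expR x in tt r0 *.
have ty : (t <= expR (b * x))%R by rewrite ler_expR ler_peMl// ltW.
have yy : (0 < expR (b * x))%R by exact: expR_gt0.
rewrite ler_pdivlMr// /averaged_share -/e ler_pdivlMr ?addr_gt0//.
move: k0 ek ty yy; set k := (e^-1)%R; set y := expR (b * x) => k0 ek ty yy.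
have -> : ((e - e ^+ 2 * t) * t * (k + y) =
  t * (e * k) + e * t * y - t ^+ 2 * e * (e * k) - e ^+ 2 * t ^+ 2 * y)%R by ring.
rewrite ek !mulr1.
rewrite -subr_ge0 (_ : (_ - _ = (y - t) * ((1 - e * t / 2) ^+ 2 +
  3 / 4 * (e * t) ^+ 2) + t * (e * t) ^+ 2)%R); last by field.
apply: addr_ge0; apply: mulr_ge0; rewrite ?sqr_ge0 ?(ltW tt) ?subr_ge0//.
by apply: addr_ge0; rewrite ?sqr_ge0// mulr_ge0 ?sqr_ge0.
Qed.

End mean_high_sum.
(** * Expectation of the overlap *)

Lemma ae_lty d (T : measurableType d) (R : realType)
    (mu : {measure set T -> \bar R}) (f : T -> \bar R) :
  (forall t, 0 <= f t)%E -> measurable_fun setT f ->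
  (\int[mu]_t f t < +oo)%E -> {ae mu, forall t, (f t < +oo)%E}.
Proof.
move=> f0 mf fint; have fi : mu.-integrable setT f.
  by apply/integrableP; split => //; under eq_integral do rewrite gee0_abs//.
have := integrable_ae measurableT fi; apply: filterS => t /(_ I).
by rewrite ge0_fin_numE.
Qed.

Section overlap_expectation.
Local Open Scope ereal_scope.
Context d (T : measurableType d) (R : realType) (P : probability T R).
Variable xi : nat -> {RV P >-> R}.
Hypothesis hxi : poisson_point_process (@rem_intensity R) xi.

(** The definitions on sequences of functions expect the atoms without their
    structure of random variables. *)
Let xT (i : nat) : T -> R := xi i.

Lemma measurable_exp_sum c :
  measurable_fun setT (fun w => \sum_(i <oo) (expR (c * xi i w))%:E).
Proof.
apply: ge0_emeasurable_sum => [k x _ _|k _]; first by rewrite lee_fin expR_ge0.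
apply/measurable_EFinP; apply: (measurableT_comp (measurable_expRM c)).
exact: measurable_funP.
Qed.

Lemma measurable_low_sum c : measurable_fun setT (fun w => low_sum c (xi ^~ w)).
Proof.
apply: ge0_emeasurable_sum => [k x _ _|k _]; first exact: low_weight_ge0.
exact: (measurableT_comp (measurable_low_weight c)).
Qed.

Lemma measurable_high_sum b : (1 < b)%R ->
  measurable_fun setT (fun w => high_sum b (xi ^~ w)).
Proof.
move=> b1; apply: ge0_emeasurable_sum => [k x _ _|k _].
  by rewrite lee_fin mulr_ge0// averaged_share_ge0.
exact: (measurableT_comp (measurable_high_weight b1)).
Qed.

Let measurable_excess (A : set R) : measurable A ->
  measurable_fun setT (fun w => maxe (atom_count xi w A - 1) 0).
Proof.
move=> mA; apply: measurable_maxe => //; apply: emeasurable_funB => //.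
exact: measurable_atom_count.
Qed.

Lemma measurable_excess_sum b : measurable_fun setT (excess_sum xT b).
Proof.
apply: ge0_emeasurable_sum => [k x _ _|k _].
  by rewrite mule_ge0 ?lee_fin ?expR_ge0// le_max lexx orbT.
by apply: emeasurable_funM => //; exact: measurable_excess.
Qed.

Lemma measurable_overlap b b' : measurable_fun setT (rem_overlap xT b b').
Proof.
have mf (f : T -> \bar R) : measurable_fun setT f -> measurable_fun setT (fine \o f).
  by move=> ?; exact: measurableT_comp.
have ms c : measurable_fun setT (fun w => fine (\sum_(i <oo) (expR (c * xi i w))%:E)).
  exact: mf (measurable_exp_sum c).
pose D w := (fine (\sum_(i <oo) (expR (b * xi i w))%:E) *
             fine (\sum_(i <oo) (expR (b' * xi i w))%:E))%R.
have s0 c w : (0 <= fine (\sum_(i <oo) (expR (c * xi i w))%:E))%R.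
  by rewrite fine_ge0// nneseries_ge0// => i _ _; rewrite lee_fin expR_ge0.
apply: measurable_funM.
  apply: mf; apply: ge0_emeasurable_sum => [k x _ _|k _].
    by rewrite lee_fin mulr_ge0 ?expR_ge0.
  apply/measurable_EFinP; apply: measurable_funM;
    by apply: (measurableT_comp (measurable_expRM _)); exact: measurable_funP.
rewrite [X in measurable_fun _ X](_ : _ = (@powR R ^~ (-1)%R) \o D).
  apply: measurableT_comp; first exact: measurable_powR.
  by apply: measurable_funM; exact: ms.
by apply/funext => w; rewrite /= powR_inv1// mulr_ge0.
Qed.

(** The term of index [k] is at most [expR (b * (k + 1) - 2 * k)], hence at most
    [expR (3 / 2)] times the [k]-th power of [expR (- 1 / 2)]. *)
Lemma mean_excess_sum b : (b <= 3 / 2)%R ->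
  \int[P]_w excess_sum xT b w <= (expR (3 / 2) / (1 - expR (- 2^-1)))%:E.
Proof.
move=> b32; set q := expR (- 2^-1).
have q0 : (0 < q)%R by exact: expR_gt0.
have q1 : (q < 1)%R by rewrite -expR0 ltr_expR oppr_lt0.
have tail (k : nat) : rem_intensity `]k%:R, +oo[ = (expR (- (k%:R : R)))%:E.
  exact: rem_intensity_itvoy.
rewrite /excess_sum integral_nneseries//; last 2 first.
- by move=> k; apply: emeasurable_funM => //; exact: measurable_excess.
- by move=> k w _; rewrite mule_ge0 ?lee_fin ?expR_ge0// le_max lexx orbT.
have -> : (expR (3 / 2) / (1 - q))%:E = \sum_(k <oo) (expR (3 / 2) * q ^+ k)%:E.
  apply/esym/cvg_lim => //.
  have := @cvg_geometric_series R (expR (3 / 2)) q.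
  rewrite ger0_norm ?ltW// => /(_ q1) h.
  rewrite (_ : (fun n => _) = EFin \o series (geometric (expR (3 / 2)) q)).
    by apply: cvg_EFin => //; exact: nearW.
  by apply/funext => n; rewrite /= /series/= -sumEFin.
apply: lee_nneseries => [k _ _|k _].
  apply: integral_ge0 => w _.
  by rewrite mule_ge0 ?lee_fin ?expR_ge0// le_max lexx orbT.
rewrite ge0_integralZl//; last 2 first.
- exact: measurable_excess.
- by move=> w _; rewrite le_max lexx orbT.
have r0 : (0 <= expR (- (k%:R : R)))%R by exact: expR_ge0.
have mN : measurable_fun setT (fun w => atom_count xT w `]k%:R, +oo[).
  exact: measurable_atom_count.
have NP j : P [set w | atom_count xT w `]k%:R, +oo[ = j%:R%:E] =
    poisson_prob (expR (- (k%:R : R))) 0%N [set j].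
  by case: hxi => + _ _; apply.
apply: (@le_trans _ _ ((expR (b * k.+1%:R))%:E * (expR (- k%:R) ^+ 2)%:E)).
  by rewrite lee_wpmul2l ?lee_fin ?expR_ge0//; exact: poisson_excess r0 mN NP.
rewrite -EFinM lee_fin -!expRM_natl -!expRD ler_expR -natr1.
have k0 : (0 <= k%:R :> R)%R by [].
by move: b32; nra.
Qed.

Let ae_high_count : {ae P, forall w, atom_count xT w `]0%R, +oo[ < +oo}.
Proof.
apply: ae_lty => [w||]; first exact: atom_count_ge0.
  exact: measurable_atom_count.
rewrite (_ : \int[P]_w _ = (expR (- 0))%:E) ?ltry//.
by rewrite (mean_atom_count hxi)//; exact: rem_intensity_itvoy.
Qed.

Let ae_exp_sum c : (1 < c)%R ->
  {ae P, forall w, \sum_(i <oo) (expR (c * xi i w))%:E < +oo}.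
Proof.
move=> c1; have low : {ae P, forall w, low_sum c (xi ^~ w) < +oo}.
  apply: ae_lty; last by rewrite (mean_low_sum hxi)// ltry.
  - by move=> w; apply: nneseries_ge0 => i _ _; exact: low_weight_ge0.
  - exact: measurable_low_sum.
apply: filterS2 ae_high_count low => w; exact: (@exp_sum_lty R T xT w c).
Qed.

Let low_sum_ge0 c w : 0 <= low_sum c (xi ^~ w).
Proof. by apply: nneseries_ge0 => i _ _; exact: low_weight_ge0. Qed.

Let high_sum_ge0 b w : (1 < b)%R -> 0 <= high_sum b (xi ^~ w).
Proof.
move=> b1; apply: nneseries_ge0 => i _ _.
by rewrite lee_fin mulr_ge0// averaged_share_ge0.
Qed.

Let excess_sum_ge0 b w : 0 <= excess_sum xT b w.
Proof.
apply: nneseries_ge0 => k _ _.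
by rewrite mule_ge0 ?lee_fin ?expR_ge0// le_max lexx orbT.
Qed.

Let high_intensity b :=
  \int[@rem_intensity R]_x (averaged_share b x * \1_(`]0%R, +oo[) x)%:E.

Let mean_high_sum b : (1 < b)%R ->
  \int[P]_w high_sum b (xi ^~ w) = high_intensity b.
Proof.
move=> b1; apply: (campbell hxi
  (f := fun x => (averaged_share b x * \1_(`]0%R, +oo[) x)%:E)).
  by move=> x; rewrite lee_fin mulr_ge0// averaged_share_ge0.
exact: measurable_high_weight.
Qed.

Let EQ b b' := \int[P]_w (rem_overlap xT b b' w)%:E.

Lemma mean_overlap_le b b' : (1 < b)%R -> (1 < b')%R ->
  EQ b b' <= high_intensity b + (5 * (b - 1))%:E.
Proof.
move=> b1 b'1; have e0 : (0 <= b - 1)%R by rewrite subr_ge0 ltW.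
have mQ : measurable_fun setT (fun w => (rem_overlap xT b b' w)%:E).
  by apply/measurable_EFinP; exact: measurable_overlap.
have mH := measurable_high_sum b1.
have mZ := measurable_low_deviation hxi b1.
pose Z := low_deviation xi b.
have Z0 w : 0 <= Z w by exact: low_deviation_ge0.
apply: (@le_trans _ _ (\int[P]_w
    (high_sum b (xi ^~ w) + ((b - 1)%:E + (b - 1)%:E * Z w)))).
  apply: ae_ge0_le_integral => //.
  - by move=> w _; rewrite lee_fin rem_overlap_ge0.
  - by move=> w _; rewrite !adde_ge0 ?high_sum_ge0// mule_ge0.
  - apply: emeasurable_funD => //; apply: emeasurable_funD => //.
    exact: emeasurable_funM.
  apply: filterS2 (ae_exp_sum b1) (ae_exp_sum b'1) => w sw sw' _.
  rewrite addeA; apply: overlap_le => //.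
  exact: low_sum_ge.
rewrite ge0_integralD//; last 3 first.
- by move=> w _; exact: high_sum_ge0.
- by move=> w _; rewrite adde_ge0// mule_ge0.
- by apply: emeasurable_funD => //; exact: emeasurable_funM.
rewrite mean_high_sum// leeD2l// ge0_integralD//; last 2 first.
- by move=> w _; rewrite mule_ge0.
- exact: emeasurable_funM.
rewrite integral_cst//= probability_setT mule1 ge0_integralZl//.
apply: (@le_trans _ _ ((b - 1)%:E + (b - 1)%:E * 4%:E)).
  by rewrite leeD2l// lee_wpmul2l//; exact: mean_low_deviation.
by rewrite -EFinM -EFinD lee_fin; lra.
Qed.

Lemma mean_overlap_ge b b' (C : R) : (1 < b)%R -> (b <= b')%R ->
  \int[P]_w excess_sum xT b w <= C%:E ->
  high_intensity b <=
  EQ b b' + ((b - 1) * (3 * C + 8 + (b' - 1)^-1))%:E.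
Proof.
move=> b1 bb' WC; have e0 : (0 <= b - 1)%R by rewrite subr_ge0 ltW.
have b'1 : (1 < b')%R by exact: lt_le_trans bb'.
have mQ : measurable_fun setT (fun w => (rem_overlap xT b b' w)%:E).
  by apply/measurable_EFinP; exact: measurable_overlap.
have mZ := measurable_low_deviation hxi b1.
pose Z := low_deviation xi b.
have Z0 w : 0 <= Z w by exact: low_deviation_ge0.
have mW := measurable_excess_sum b.
have mL := measurable_low_sum b'.
pose B w := 3%:E * excess_sum xT b w + 2%:E * Z w + low_sum b' (xi ^~ w).
have W0 w : 0 <= 3%:E * excess_sum xT b w by rewrite mule_ge0// lee_fin.
have Z20 w : 0 <= 2%:E * Z w by rewrite mule_ge0// lee_fin.
have mW3 : measurable_fun setT (fun w => 3%:E * excess_sum xT b w).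
  exact: emeasurable_funM.
have mZ2 : measurable_fun setT (fun w => 2%:E * Z w) by exact: emeasurable_funM.
have B0 w : 0 <= B w by rewrite !adde_ge0.
have mB : measurable_fun setT B.
  by apply: emeasurable_funD => //; exact: emeasurable_funD.
rewrite -mean_high_sum//.
apply: (@le_trans _ _ (\int[P]_w ((rem_overlap xT b b' w)%:E + (b - 1)%:E * B w))).
  apply: ae_ge0_le_integral => //.
  - by move=> w _; exact: high_sum_ge0.
  - exact: measurable_high_sum.
  - by move=> w _; rewrite adde_ge0 ?lee_fin ?rem_overlap_ge0// mule_ge0.
  - by apply: emeasurable_funD => //; exact: emeasurable_funM.
  apply: filterS3 ae_high_count (ae_exp_sum b1) (ae_exp_sum b'1) => w Nw sw sw' _.
  apply: overlap_ge => //; first exact: low_sum_le.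
  exact: low_sum_ge.
rewrite ge0_integralD//; last 3 first.
- by move=> w _; rewrite lee_fin rem_overlap_ge0.
- by move=> w _; rewrite mule_ge0.
- exact: emeasurable_funM.
rewrite leeD2l// ge0_integralZl// EFinM lee_wpmul2l//.
rewrite ge0_integralD//; last 2 first.
- by move=> w _; exact: adde_ge0.
- exact: emeasurable_funD.
rewrite (mean_low_sum hxi)// [leRHS]EFinD leeD2r// ge0_integralD// !ge0_integralZl//.
rewrite [leRHS]EFinD; apply: leeD; first by rewrite EFinM lee_wpmul2l.
rewrite (_ : 8%R = 2 * 4)%R; last by ring.
rewrite EFinM lee_wpmul2l//; exact: mean_low_deviation.
Qed.

Lemma overlap_asymptotic b b' : (1 < b)%R -> (b <= b')%R -> (b - 1 <= 16^-1)%R ->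
  (`|fine (EQ b b') - (b - 1) * ln (1 / (b - 1))| <=
   (17 + 3 * (expR (3 / 2) / (1 - expR (- 2^-1))) + (b' - 1)^-1) * (b - 1))%R.
Proof.
move=> b1 bb' be; have e0 : (0 < b - 1)%R by rewrite subr_gt0.
have b'1 : (1 < b')%R by exact: lt_le_trans bb'.
have b32 : (b <= 3 / 2)%R by move: be; lra.
have up := mean_overlap_le b1 b'1.
have lo := mean_overlap_ge b1 bb' (mean_excess_sum b32).
have Jup := high_intensity_le b1 be.
have Jlo := high_intensity_ge b1 be.
have EQ0 : 0 <= EQ b b' by apply: integral_ge0 => w _; rewrite lee_fin rem_overlap_ge0.
have J0 : 0 <= high_intensity b.
  by apply: integral_ge0 => x _; rewrite lee_fin mulr_ge0// averaged_share_ge0.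
move: up lo Jup Jlo EQ0 J0; rewrite -/(high_intensity b).
case: (high_intensity b) => [J| |//]; last by move=> _ _; rewrite leye_eq.
case: (EQ b b') => [q|//|//]; rewrite -!EFinD !lee_fin /=.
move=> up lo Jup Jlo _ _.
set C := (expR (3 / 2) / _)%R in lo *.
have C0 : (0 <= C)%R.
  apply: divr_ge0; first exact: expR_ge0.
  by rewrite subr_ge0 -[leRHS]expR0 ler_expR oppr_le0 invr_ge0.
have i0 : (0 <= (b' - 1)^-1)%R by rewrite invr_ge0 subr_ge0 ltW.
move: (b - 1)%R (ln _) ((b' - 1)^-1)%R e0 i0 up lo Jup Jlo => e L i e0 i0 up lo Jup Jlo.
have h1 : (0 <= e * C)%R by rewrite mulr_ge0// ltW.
have h2 : (0 <= e * i)%R by rewrite mulr_ge0// ltW.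
by rewrite ler_norml; apply/andP; split; nra.
Qed.

End overlap_expectation.

Theorem theorem1p1 (R : realType) (d : measure_display) (T : measurableType d)
  (P : probability T R) (xi : nat -> {RV P >-> R})
  (hxi : poisson_point_process (@rem_intensity R) xi)
  (b' : R) (hb' : 1 < b') :
  (fun b : R => fine ('E_P[rem_overlap xi b b'])%E)
    = (fun b : R => (b - 1) * ln (1 / (b - 1))) +O_ (1^'+) (fun b : R => b - 1).
Proof.
apply/eqaddOP.
set K := 17 + 3 * (expR (3 / 2) / (1 - expR (- 2^-1))) + (b' - 1)^-1.
near=> k; near=> b.
have b1 : 1 < b by near: b; exact: nbhs_right_gt.
have bb' : b <= b' by near: b; exact: nbhs_right_le.
have be : b - 1 <= 16^-1.
  by rewrite lerBlDl; near: b; apply: nbhs_right_le; rewrite ltrDl.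
have Kk : K <= k by near: k; exact: nbhs_pinfty_ge.
rewrite /= unlock [leRHS](_ : _ = k * (b - 1)); last first.
  by rewrite ger0_norm// subr_ge0 ltW.
apply: (le_trans (overlap_asymptotic hxi b1 bb' be)).
by rewrite ler_wpM2r// subr_ge0 ltW.
Unshelve. all: by end_near. Qed.
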